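(* Let $J=J(\{a_j\},\{b_j\},\{c_j\})_{j\in\mathbb N}$ be a semi-infinite Jacobi matrix with $J-J_0\in\mathcal S_1$, let $\Delta:=\sum_{n=1}^\infty(|b_n|+|1-a_nc_n|)$, and let $L(\lambda,J)=\det\bigl(I+(J-J_0)(J_0-\lambda)^{-1}\bigr)$ be the perturbation determinant. Then, with $\lambda(z)=z+\frac1z$, $$\log|L(\lambda(z),J)|\le\frac{2|z|\,\Delta}{|1-z|\,|1+z|},\qquad z\in\mathbb D.$$ If, in addition, $$\Delta_1:=\sum_{n=1}^\infty n\bigl(|b_n|+|1-a_{n-1}c_{n-1}|\bigr)<\infty,\qquad a_0=c_0:=1,$$ then $$\log|L(\lambda(z),J)|\le|z|\,\Delta_1,\qquad z\in\overline{\mathbb D}.$$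
   Context: $\mathbb N=\{1,2,\dots\}$; $\mathbb D$ is the open unit disk and $\overline{\mathbb D}$ its closure. $J=J(\{a_j\},\{b_j\},\{c_j\})_{j\in\mathbb N}$ is the operator on $\ell^2(\mathbb N)$ given by the semi-infinite tridiagonal matrix with diagonal entries $J_{k,k}=b_k$, superdiagonal entries $J_{k,k+1}=c_k$ and subdiagonal entries $J_{k+1,k}=a_k$, $k\ge1$, where $a_k,b_k,c_k$ are uniformly bounded complex numbers and $a_kc_k\ne0$ for all $k\in\mathbb N$. $J_0=J(\{1\},\{0\},\{1\})$ is the discrete Laplacian on the half-line, with spectrum $[-2,2]$. $\mathcal S_1$ is the trace class; $J-J_0\in\mathcal S_1$ is equivalent to $\sum_{n\ge1}(|1-a_n|+|b_n|+|1-c_n|)<\infty$. The map $\lambda(z)=z+1/z$ sends $\mathbb D$ onto $\overline{\mathbb C}\setminus[-2,2]$ (with $\lambda(0)=\infty$), and $L(\infty,J)=1$, so $z\mapsto L(\lambda(z),J)$ is analytic in $\mathbb D$; $\det$ is the Fredholm determinant. Under the condition $\Delta_1<\infty$, this function extends continuously to $\overline{\mathbb D}$, and $L(\lambda(z),J)$ for $|z|=1$ denotes this continuous extension. Convention: $\log0=-\infty$. *)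

(* Defs.v *)
From HB Require Import structures.
From mathcomp Require Import all_boot all_order all_algebra.
From mathcomp Require Import complex.
From mathcomp Require Import all_classical all_reals all_analysis.
From mathcomp Require Import ring.

Set Implicit Arguments.
Unset Strict Implicit.
Unset Printing Implicit Defensive.

Import Order.TTheory GRing.Theory Num.Theory.
Import numFieldNormedType.Exports Normc.

Local Open Scope classical_set_scope.
Local Open Scope complex_scope.
Local Open Scope ring_scope.

HB.instance Definition _ (R : realType) := NormedModule.copy R[i] (R[i]^o).

(* [normc : R[i] -> R] is the real-valued modulus; the MathComp norm `|z| of a
   complex number lives in R[i]. *)

Section Ell2.
Variable R : realType.

Definition square_summable : {pred nat -> R[i]} :=
  fun u => `[< cvgn (series (fun n => normc (u n) ^+ 2)) >].

Lemma normc_ge0 (z : R[i]) : 0 <= normc z.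
Proof. by case: z => x y; exact: sqrtr_ge0. Qed.

Lemma normcD2_le (z w : R[i]) :
  normc (z + w) ^+ 2 <= 2 * normc z ^+ 2 + 2 * normc w ^+ 2.
Proof.
apply: (@le_trans _ _ ((normc z + normc w) ^+ 2)).
  by rewrite lerXn2r ?nnegrE ?addr_ge0 ?normc_ge0 ?le_normcD.
rewrite -subr_ge0; have -> : 2 * normc z ^+ 2 + 2 * normc w ^+ 2 -
    (normc z + normc w) ^+ 2 = (normc z - normc w) ^+ 2.
  by ring.
exact: sqr_ge0.
Qed.

Lemma square_summable_le (u v : nat -> R[i]) (M : R) :
  (forall n, normc (u n) <= M * normc (v n)) ->
  v \in square_summable -> u \in square_summable.
Proof.
move=> uv /asboolP cv; apply/asboolP.
apply: (@series_le_cvg _ _ (fun n => M ^+ 2 * normc (v n) ^+ 2)) => [n|n|n|].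
- exact: sqr_ge0.
- by rewrite mulr_ge0 ?sqr_ge0.
- rewrite -exprMn lerXn2r ?nnegrE ?normc_ge0 ?uv//.
  exact: le_trans (normc_ge0 _) (uv n).
- have -> : (fun n => M ^+ 2 * normc (v n) ^+ 2) =
            M ^+ 2 *: (fun n => normc (v n) ^+ 2) by [].
  exact: is_cvg_seriesZ.
Qed.

Lemma square_summableD (u v : nat -> R[i]) :
  u \in square_summable -> v \in square_summable ->
  u + v \in square_summable.
Proof.
move=> /asboolP cu /asboolP cv; apply/asboolP.
apply: (@series_le_cvg _ _ (fun n => 2 * normc (u n) ^+ 2 +
                                     2 * normc (v n) ^+ 2)) => [n|n|n|].
- exact: sqr_ge0.
- apply: addr_ge0; apply: mulr_ge0; [exact: ler0n | exact: sqr_ge0| exact: ler0n | exact: sqr_ge0].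
- exact: normcD2_le.
- have -> : (fun n => 2 * normc (u n) ^+ 2 + 2 * normc (v n) ^+ 2) =
            (2 : R) *: (fun n => normc (u n) ^+ 2) +
            (2 : R) *: (fun n => normc (v n) ^+ 2) by [].
  by apply: is_cvg_seriesD; exact: is_cvg_seriesZ.
Qed.

Lemma square_summableZ (k : R[i]) (u : nat -> R[i]) :
  u \in square_summable -> k *: u \in square_summable.
Proof.
by apply: (@square_summable_le _ _ (normc k)) => n; rewrite -normcM.
Qed.

Lemma square_summable_fin (u : nat -> R[i]) (N : nat) :
  (forall n, (N <= n)%N -> u n = 0) -> u \in square_summable.
Proof.
move=> u0; apply/asboolP; apply/cvg_ex.
exists (series (fun n => normc (u n) ^+ 2) N).
apply: cvg_near_cst; near=> n.
have Nn : (N <= n)%N by near: n; exact: nbhs_infty_ge.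
rewrite /series /= (@big_cat_nat _ _ _ N) //= [X in _ + X]big1_seq ?addr0 //.
by move=> i; rewrite mem_index_iota => /andP[_ /andP[Ni _]];
  rewrite u0// normc0 expr0n.
Unshelve. all: by end_near. Qed.

Lemma square_summable_succ (u : nat -> R[i]) :
  u \in square_summable -> (fun n => u n.+1) \in square_summable.
Proof.
move=> /asboolP su; apply/asboolP.
have -> : series (fun n => normc (u n.+1) ^+ 2) =
    (fun n => series (fun n => normc (u n) ^+ 2) n.+1 - normc (u 0%N) ^+ 2).
  apply/funext => n; rewrite /series /= [in RHS]big_nat_recl//.
  by rewrite addrAC subrr add0r.
apply: is_cvgB; last exact: is_cvg_cst.
by apply/cvg_ex; move/cvg_ex: su => [l sl]; exists l; rewrite cvg_shiftS.
Qed.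

Lemma square_summable_pred (u : nat -> R[i]) :
  u \in square_summable ->
  (fun n => if n is m.+1 then u m else 0) \in square_summable.
Proof.
move=> /asboolP su; apply/asboolP; move/cvg_ex: su => [l sl].
apply/cvg_ex; exists l; rewrite -cvg_shiftS /=; apply: cvg_trans sl.
apply: near_eq_cvg; apply: nearW => n.
by rewrite /series /= [in RHS]big_nat_recl// normc0 expr0n add0r.
Qed.

Lemma square_summable0 : 0 \in square_summable.
Proof. by apply: (@square_summable_fin _ 0). Qed.

Lemma square_summable_submod : submod_closed square_summable.
Proof.
split=> [|k u v uP vP]; first exact: square_summable0.
by apply: square_summableD => //; exact: square_summableZ.
Qed.

HB.instance Definition _ :=
  GRing.isSubmodClosed.Build R[i] (nat -> R[i]) square_summable
    square_summable_submod.

(* l^2({1, 2, ...}), with coordinates numbered from 0: [x n] is the (n+1)-st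
   coordinate of x. *)
Record ell2 := Ell2 {
  ell2_fun :> nat -> R[i];
  ell2P : ell2_fun \in square_summable }.

HB.instance Definition _ := [isSub for ell2_fun].
HB.instance Definition _ := [Choice of ell2 by <:].
HB.instance Definition _ := [SubChoice_isSubLmodule of ell2 by <:].

Definition l2norm (x : ell2) : R :=
  Num.sqrt (limn (series (fun n => normc (x n) ^+ 2))).

Definition l2dot (x y : ell2) : R[i] :=
  limn (series (fun n => x n * (y n)^*)).

Lemma l2basis_subproof (j : nat) :
  (fun n => (n == j)%:R : R[i]) \in square_summable.
Proof.
by apply: (@square_summable_fin _ j.+1) => n jn; rewrite gtn_eqF.
Qed.

Definition l2basis (j : nat) : ell2 := Ell2 (l2basis_subproof j).

Definition bounded_operator (T : ell2 -> ell2) : Prop :=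
  linear T /\ exists M : R, forall x, l2norm (T x) <= M * l2norm x.

(* The bounded inverse of T (and 0 when T is not boundedly invertible). *)
Definition operator_inv (T : ell2 -> ell2) : ell2 -> ell2 :=
  xget (fun=> 0) [set S | [/\ bounded_operator S, cancel T S & cancel S T]].

Definition resolvent (T : ell2 -> ell2) (lam : R[i]) : ell2 -> ell2 :=
  operator_inv (fun x => T x - lam *: x).

Definition orthonormal_seq (e : nat -> ell2) : Prop :=
  forall j k, l2dot (e j) (e k) = (j == k)%:R.

(* The trace class through the Schmidt (singular value) expansion
   T = \sum_k s_k <., e_k> f_k with summable singular values s_k.  As l^2 is
   infinite-dimensional, e and f can always be taken to be infinite sequences,
   padding with s_k = 0 when T has finite rank. *)
Definition trace_class (T : ell2 -> ell2) : Prop :=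
  exists (s : nat -> R) (e f : nat -> ell2),
    [/\ forall k, 0 <= s k, orthonormal_seq e, orthonormal_seq f,
        cvgn (series s) &
        forall x, (fun n => l2norm
          (T x - \sum_(k < n) ((s k)%:C * l2dot x (e k)) *: f k)) @ \oo --> 0].

Definition entry (T : ell2 -> ell2) (i j : nat) : R[i] := T (l2basis j) i.

(* Tr(Lambda^k T) = 1/k! \sum_(i_1, ..., i_k) det (T_(i_p, i_q)), the k-th term
   of the Fredholm expansion; the sum over all k-tuples of indices is absolutely
   convergent for T of trace class and is taken along the boxes [0, n)^k. *)
Definition trace_ext (T : ell2 -> ell2) (k : nat) : R[i] :=
  limn (fun n : nat => (k`!%:R)^-1 *
    \sum_(f : {ffun 'I_k -> 'I_n}) \det (\matrix_(p, q) entry T (f p) (f q))).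

(* det(I + T) = \sum_k Tr(Lambda^k T): the argument T is the trace class
   perturbation, not I + T. *)
Definition fredholm_det (T : ell2 -> ell2) : R[i] :=
  limn (series (trace_ext T)).

End Ell2.

Section Jacobi.
Variable R : realType.

(* The sequences are used at n >= 1 only; their value at 0 is irrelevant. *)
Record jacobi := Jacobi {
  ja : nat -> R[i];
  jb : nat -> R[i];
  jc : nat -> R[i];
  jacobi_bounded : exists M : R, forall n, (0 < n)%N ->
    [/\ normc (ja n) <= M, normc (jb n) <= M & normc (jc n) <= M];
  jacobi_neq0 : forall n, (0 < n)%N -> ja n * jc n != 0 }.

(* Row n+1 of the tridiagonal matrix: subdiagonal entry a_n (absent if n = 0),
   diagonal entry b_(n+1), superdiagonal entry c_(n+1). *)
Definition jacobi_fun (J : jacobi) (u : nat -> R[i]) : nat -> R[i] :=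
  fun n => (if n is m.+1 then ja J n * u m else 0)
           + jb J n.+1 * u n + jc J n.+1 * u n.+1.

Lemma jacobi_subproof (J : jacobi) (u : ell2 R) :
  jacobi_fun J u \in @square_summable R.
Proof.
have [M MP] := jacobi_bounded J.
have uP := ell2P u.
have aP : (fun n => if n is m.+1 then ja J n * u m else 0)
    \in @square_summable R.
  apply: (square_summable_le (M := M) _ (square_summable_pred uP)) => -[|n].
    by rewrite normc0 mulr0.
  by rewrite normcM ler_wpM2r ?normc_ge0//; case: (MP n.+1).
have bP : (fun n => jb J n.+1 * u n) \in @square_summable R.
  apply: (square_summable_le (M := M) _ uP) => n.
  by rewrite normcM ler_wpM2r ?normc_ge0//; case: (MP n.+1).
have cP : (fun n => jc J n.+1 * u n.+1) \in @square_summable R.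
  apply: (square_summable_le (M := M) _ (square_summable_succ uP)) => n.
  by rewrite normcM ler_wpM2r ?normc_ge0//; case: (MP n.+1).
exact: square_summableD (square_summableD aP bP) cP.
Qed.

Definition jacobi_op (J : jacobi) (u : ell2 R) : ell2 R :=
  Ell2 (jacobi_subproof J u).

Lemma free_jacobi_bounded : exists M : R, forall n, (0 < n)%N ->
  [/\ normc ((fun=> 1 : R[i]) n) <= M, normc ((fun=> 0 : R[i]) n) <= M &
      normc ((fun=> 1 : R[i]) n) <= M].
Proof. by exists 1 => n _; rewrite normc1 normc0; split. Qed.

Lemma free_jacobi_neq0 (n : nat) : (0 < n)%N ->
  (fun=> 1 : R[i]) n * (fun=> 1 : R[i]) n != 0.
Proof. by move=> _; rewrite mulr1 oner_neq0. Qed.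

Definition free_jacobi : jacobi :=
  @Jacobi (fun=> 1) (fun=> 0) (fun=> 1) free_jacobi_bounded free_jacobi_neq0.

Definition jacobi_perturbation (J : jacobi) : ell2 R -> ell2 R :=
  jacobi_op J \- jacobi_op free_jacobi.

Definition perturbation_det (J : jacobi) (lam : R[i]) : R[i] :=
  fredholm_det
    (jacobi_perturbation J \o resolvent (jacobi_op free_jacobi) lam).

(* z |-> L(lambda(z), J) on the open unit disk, with lambda(0) = oo and
   L(oo, J) = 1. *)
Definition disk_det (J : jacobi) (z : R[i]) : R[i] :=
  if z == 0 then 1 else perturbation_det J (z + z^-1).

Definition Delta (J : jacobi) : \bar R :=
  (\sum_(1 <= n <oo) (normc (jb J n) + normc (1 - ja J n * jc J n))%:E)%E.

(* a_n c_n, with the convention a_0 = c_0 = 1. *)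
Definition jac (J : jacobi) (n : nat) : R[i] :=
  if n is 0%N then 1 else ja J n * jc J n.

Definition Delta1 (J : jacobi) : \bar R :=
  (\sum_(1 <= n <oo)
     (n%:R * (normc (jb J n) + normc (1 - jac J n.-1)))%:E)%E.

End Jacobi.

(* Main.v *)
Require Import Defs.
From mathcomp Require Import all_boot all_order all_algebra.
From mathcomp Require Import all_fingroup complex.
From mathcomp Require Import all_classical all_reals all_analysis.
From mathcomp Require Import ring lra.
Set Implicit Arguments.
Unset Strict Implicit.
Unset Printing Implicit Defensive.
Import Order.TTheory GRing.Theory Num.Theory.
Import numFieldNormedType.Exports Normc.
Local Open Scope ring_scope.

(** Only the products a_n c_n and the entries b_n matter, and the perturbation
determinant is the Jost function: with lambda = z + 1/z it is the value at 0 of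
the solution f of
  f_(m-1) = (z^2 + 1 - z b_m) f_m - a_m c_m z^2 f_(m+1)
that tends to 1 at infinity (z^m f_m is, up to a gauge factor, the decaying
solution of J u = lambda u).  Variation of constants turns this recurrence into
a Volterra equation whose kernel, z (1 + z^2 + ... + z^(2(k-1))), is bounded
both by 2|z| / (|1 - z| |1 + z|) and by k |z|; Gronwall's inequality then gives
the two exponential estimates.  This is [jost_bound]; the same argument applied
to the difference of two solutions is [jost_stability], which shows that
truncated Jost functions converge uniformly on the closed disk under the
stronger summability condition, hence the continuous extension.

The remaining work is to identify the Fredholm determinant with the limit of
truncated Jost functions.  Trace class operators have absolutely summable
diagonals above, on and below the main one
([trace_class_diagonal_summable]), so J - J0 has summable entries.  The
resolvent of J0 is explicit because -z (J0 - lambda) = (1 - z L)(1 - z R) with L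
and R the two shifts ([resolventK], [green]).  Consequently the rows of
(J - J0)(J0 - lambda)^(-1) have summable l1 norms, and a dominated convergence
argument identifies the Fredholm series with the limit of the determinants of
the finite sections 1 + T_n ([fredholm_cvg]).  Finally the finite section of
the free resolvent is the inverse of a tridiagonal matrix with one modified
corner, since Green's function satisfies u_(n+1) = z u_n beyond its pole.  So
det (1 + T_n) is a quotient of two such tridiagonal determinants, and each of
these is a truncated Jost function up to the same power of z ([det_corner_mx],
[det_kernel]). *)

(** * Principal minors *)

(** Allows a principal minor taken along an injection to be moved to the
upper left corner. *)
Lemma inj_extend_perm k m (f : 'I_k -> 'I_(k + m)) : injective f ->
  exists s : 'S_(k + m), forall p, s (lshift m p) = f p.
Proof.
move=> f_inj; set C := ~: [set f p | p in 'I_k].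
have cardC : #|C| = m.
  by apply: (@addnI k); rewrite -{1}[k]card_ord -(card_imset _ f_inj) cardsC card_ord.
pose g (i : 'I_(k + m)) := match fintype.split i with
  | inl p => f p | inr q => enum_val (cast_ord (esym cardC) q) end.
have gC q : enum_val (cast_ord (esym cardC) q) \in C by exact: enum_valP.
have fC p : f p \notin C by rewrite inE negbK imset_f.
have g_inj : injective g.
  move=> i j; rewrite /g; case: split_ordP => p ->; case: split_ordP => q -> gE.
  - by rewrite (f_inj _ _ gE).
  - by case/negP: (fC p); rewrite gE.
  - by case/negP: (fC q); rewrite -gE.
  - by have /enum_val_inj/cast_ord_inj -> := gE.
exists (perm g_inj) => p; rewrite permE /g.
by case: split_ordP => q => [/lshift_inj ->|/eqP]; rewrite ?eq_lrshift.
Qed.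

Section PrincipalMinors.
Variables (F : comNzRingType) (n : nat) (A : 'M[F]_n).

(** The matrix A with the rows outside S replaced by those of the identity: its
determinant is the principal minor of A on S, without leaving size n. *)
Definition subset_mx (S : {set 'I_n}) : 'M[F]_n :=
  \matrix_(i, j) (if i \in S then A i j else (i == j)%:R).

(** Multilinearity in the rows, read off from the Leibniz formula. *)
Lemma det_1D_subset : \det (1%:M + A) = \sum_(S : {set 'I_n}) \det (subset_mx S).
Proof.
rewrite addrC /determinant exchange_big /=; apply: eq_bigr => s _.
rewrite -big_distrr /=; congr (_ * _).
under eq_bigr do rewrite !mxE.
rewrite bigA_distr; apply: eq_bigr => S _; apply: eq_bigr => i _.
by rewrite mxE.
Qed.

End PrincipalMinors.

(** After a simultaneous permutation of rows and columns the identity rows form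
a lower block (0 | 1), which leaves the minor as upper left block. *)
Lemma det_subset_mx (F : comNzRingType) (n k : nat) (A : 'M[F]_n)
    (f : 'I_k -> 'I_n) : injective f ->
  \det (subset_mx A [set f p | p in 'I_k]) = \det (\matrix_(p, q) A (f p) (f q)).
Proof.
move=> f_inj.
have le_kn : (k <= n)%N by have := leq_card f f_inj; rewrite !card_ord.
move: A f f_inj; rewrite -(subnKC le_kn); move: (n - k)%N => m A f f_inj.
have [s sf] := inj_extend_perm f_inj.
set B := subset_mx _ _.
have -> : \det B = \det (\matrix_(i, j) B (s i) (s j)).
  have -> : \matrix_(i, j) B (s i) (s j) = row_perm s (col_perm s B).
    by apply/matrixP => i j; rewrite !mxE.
  rewrite row_permE col_permE !det_mulmx !det_perm odd_permV.
  by rewrite mulrCA -signr_addb addbb mulr1.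
rewrite -[X in \det X]submxK (_ : dlsubmx _ = 0); last first.
  apply/matrixP => i j; rewrite !mxE sf.
  rewrite -sf (inj_eq perm_inj) eq_rlshift ifN //; apply/imsetP => -[p _].
  by rewrite -sf => /perm_inj/eqP; rewrite eq_rlshift.
rewrite det_ublock [X in _ * \det X](_ : _ = 1%:M) ?det1 ?mulr1; last first.
  apply/matrixP => i j; rewrite !mxE ifN ?(inj_eq perm_inj) ?eq_rshift //.
  by apply/imsetP => -[p _]; rewrite -sf => /perm_inj/eqP; rewrite eq_rlshift.
by congr (\det _); apply/matrixP => p q; rewrite !mxE !sf imset_f.
Qed.

Lemma det_not_inj (F : comNzRingType) (n k : nat) (A : 'M[F]_n)
    (f : 'I_k -> 'I_n) :
  ~~ injectiveb f -> \det (\matrix_(p, q) A (f p) (f q)) = 0.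
Proof.
move=> /injectivePn[p [q npq fpq]].
by apply: (determinant_alternate npq) => j; rewrite !mxE fpq.
Qed.

(** The finite-dimensional Fredholm expansion.  Each subset S of size k is the
image of exactly k! injections, and maps that are not injective contribute
nothing. *)
Lemma det_1D_minors (F : numFieldType) (n : nat) (A : 'M[F]_n) (K : nat) :
  (n < K)%N ->
  \det (1%:M + A) = \sum_(k < K) (k`!%:R)^-1 *
    \sum_(f : {ffun 'I_k -> 'I_n}) \det (\matrix_(p, q) A (f p) (f q)).
Proof.
move=> nK; rewrite det_1D_subset.
have cardK (S : {set 'I_n}) : (#|S| < K)%N.
  by apply: leq_ltn_trans nK; rewrite -[X in (_ <= X)%N]card_ord max_card.
rewrite (partition_big (fun S => Ordinal (cardK S)) predT) //=.
apply: eq_bigr => k _.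
have kn0 : (k`!%:R : F) != 0 by rewrite pnatr_eq0 -lt0n fact_gt0.
apply: (canRL (mulKf kn0)).
rewrite [RHS](bigID (fun f : {ffun 'I_k -> 'I_n} => injectiveb f)) /=.
rewrite [X in _ + X]big1 ?addr0; last by move=> f; exact: det_not_inj.
rewrite (partition_big (fun f : {ffun 'I_k -> 'I_n} => [set f p | p in 'I_k])
   (fun S : {set 'I_n} => #|S| == k)) /=; last first.
  by move=> f /injectiveP f_inj; rewrite card_imset // card_ord.
rewrite mulr_sumr; apply: eq_big => [S|S]; first by rewrite -val_eqE.
move=> SkK; have Sk : #|S| = k by move: SkK => /eqP <-.
rewrite (eq_bigr (fun=> \det (subset_mx A S))); last first.
  by move=> f /andP[/injectiveP f_inj /eqP <-]; rewrite det_subset_mx.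
rewrite sumr_const mulr_natl; congr (_ *+ _).
transitivity (#|[set f : {ffun 'I_k -> 'I_n} in ffun_on S | injectiveb f]|).
  by rewrite card_inj_ffuns_on card_ord Sk ffactnn.
apply: eq_card => f; rewrite !inE andbC; apply: andb_id2l => /injectiveP f_inj.
apply/ffun_onP/eqP => [fS|<- p]; last exact: imset_f.
apply/eqP; rewrite eqEcard (card_imset _ f_inj) card_ord Sk leqnn andbT.
by apply/fintype.subsetP => _ /imsetP[p _ ->]; exact: fS.
Qed.

Local Open Scope classical_set_scope.
Local Open Scope complex_scope.
Local Open Scope ring_scope.

(** * The modulus of a complex number *)

Section Modulus.
Variable R : realType.
Implicit Types z w : R[i].

Lemma normc_distC z w : normc (z - w) = normc (w - z).
Proof. by rewrite -normcN opprB. Qed.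

Lemma normc_sum (I : Type) (r : seq I) (P : pred I) (f : I -> R[i]) :
  normc (\sum_(i <- r | P i) f i) <= \sum_(i <- r | P i) normc (f i).
Proof.
elim/big_ind2 : _ => [|x x' y y' xy xy'|//]; first by rewrite normc0.
by rewrite (le_trans (le_normcD _ _)) ?lerD.
Qed.

Lemma normc_prod (I : Type) (r : seq I) (P : pred I) (f : I -> R[i]) :
  normc (\prod_(i <- r | P i) f i) = \prod_(i <- r | P i) normc (f i).
Proof. by elim/big_rec2 : _ => [|i x y _ <-]; rewrite ?normc1 ?normcM. Qed.

Lemma normcX z n : normc (z ^+ n) = normc z ^+ n.
Proof. by elim: n => [|n IH]; rewrite ?expr0 ?normc1// !exprS normcM IH. Qed.

Lemma normc_real (x : R) : normc x%:C = `|x|.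
Proof. by rewrite /normc /= expr0n /= addr0 sqrtr_sqr. Qed.

Lemma normc_nat n : normc (n%:R : R[i]) = n%:R.
Proof. by rewrite -(rmorph_nat (real_complex R)) normc_real ger0_norm. Qed.

Lemma Re_le_normc z : `|complex.Re z| <= normc z.
Proof. by case: z => x y /=; rewrite -sqrtr_sqr ler_wsqrtr // lerDl sqr_ge0. Qed.

Lemma Im_le_normc z : `|complex.Im z| <= normc z.
Proof. by case: z => x y /=; rewrite -sqrtr_sqr ler_wsqrtr // lerDr sqr_ge0. Qed.

Lemma normc_le_ReIm z : normc z <= `|complex.Re z| + `|complex.Im z|.
Proof.
have -> : z = (complex.Re z)%:C + 'i * (complex.Im z)%:C by case: z => x y; simpc.
rewrite (le_trans (le_normcD _ _)) // normcM !normc_real /=.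
by rewrite expr0n expr1n add0r sqrtr1 mul1r; simpc.
Qed.

(** Enlarging the Leibniz sum from permutations to all maps makes it a product of
row sums. *)
Lemma normc_det_le n (M : 'M[R[i]]_n) :
  normc (\det M) <= \prod_i \sum_j normc (M i j).
Proof.
rewrite bigA_distr_bigA /= (le_trans (normc_sum _ _ _)) //.
pose pf (s : 'S_n) := finfun s.
have pf_inj : injective pf.
  by move=> s t /ffunP st; apply/permP => i; have := st i; rewrite !ffunE.
rewrite [leRHS](bigID (fun g => g \in pf @: [set: 'S_n])) /= ler_wpDr ?sumr_ge0//.
  by move=> g _; rewrite prodr_ge0 // => i _; exact: normc_ge0.
rewrite big_imset /=; last by move=> s t _ _; exact: pf_inj.
rewrite [leRHS](eq_bigl (fun=> true)); last by move=> s; rewrite in_setT.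
apply: ler_sum => s _; rewrite normcM normcX normcN normc1 expr1n mul1r normc_prod.
by apply: ler_prod => i _; rewrite normc_ge0 ffunE lexx.
Qed.

Lemma cvgn_le0 (u v : nat -> R) : (forall n, 0 <= u n <= v n) ->
  v @ \oo --> (0 : R) -> u @ \oo --> (0 : R).
Proof.
move=> uv v0; apply: (squeeze_cvgr _ (cvg_cst (0 : R)) v0).
exact: nearW.
Qed.

(** The topology of R[i] is stated with the complex-valued norm; this reduces
its limits to real ones. *)
Lemma cvg_normcP (T : Type) (F : set_system T) (FF : Filter F) (u : T -> R[i])
    (l : R[i]) :
  (u @ F --> l) <-> (fun x => normc (u x - l)) @ F --> (0 : R).
Proof.
have normE (x : R[i]) : `|x| = (normc x)%:C by [].
split=> [/cvgrPdist_lt ul|/cvgrPdist_lt ul].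
  apply/cvgrPdist_lt => e e0.
  have /ul : (0 : R[i]) < e%:C by rewrite ltcR.
  apply: filterS => n; rewrite normE ltcR sub0r normrN ger0_norm ?normc_ge0 //.
  by rewrite normc_distC.
apply/cvgrPdist_lt => -[e f]; rewrite ltcE /= => /andP[/eqP -> /ul].
apply: filterS => n; rewrite normE sub0r normrN ger0_norm ?normc_ge0 //.
by rewrite normc_distC -ltcR.
Qed.

Lemma cvgn_normcP (u : nat -> R[i]) (l : R[i]) :
  (u @ \oo --> l) <-> (fun n => normc (u n - l)) @ \oo --> (0 : R).
Proof. exact: cvg_normcP. Qed.

Lemma nneg_series_incr (f : nat -> R) : (forall n, 0 <= f n) ->
  nondecreasing_seq (series f).
Proof.
by move=> f0; apply/nondecreasing_seqP => n; rewrite /series /= big_nat_recr //= lerDl.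
Qed.

Lemma cvg_nneg_series (f : nat -> R) (B : R) : (forall n, 0 <= f n) ->
  (forall N, series f N <= B) -> cvgn (series f).
Proof.
move=> f0 fB; apply: nondecreasing_is_cvgn; first exact: nneg_series_incr.
by exists B => _ [N _ <-]; exact: fB.
Qed.

Lemma nneg_series_le_lim (f : nat -> R) n : (forall n, 0 <= f n) ->
  cvgn (series f) -> series f n <= limn (series f).
Proof. by move=> f0 fc; exact: nondecreasing_cvgn_le (nneg_series_incr f0) fc n. Qed.

Lemma complex_limn (u : nat -> R[i]) (l : R[i]) : u @ \oo --> l -> limn u = l.
Proof. by move=> ul; apply: cvg_lim => //; exact: norm_hausdorff. Qed.

Lemma normc_lim_le (u : nat -> R[i]) (l : R[i]) (v : nat -> R) (m : R) :
  u @ \oo --> l -> v @ \oo --> m ->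
  (\forall n \near \oo, normc (u n) <= v n) -> normc l <= m.
Proof.
move=> /cvgn_normcP ul vm uv.
have vm' : (fun n => v n + normc (u n - l)) @ \oo --> m.
  by rewrite -[X in _ --> X]addr0; apply: cvgD.
rewrite -(cvg_lim _ vm') //; apply: limr_ge; first by apply/cvg_ex; exists m.
apply: filterS uv => n uvn; have := le_normcD (u n) (l - u n); rewrite subrKC.
by move=> /le_trans; apply; rewrite normc_distC lerD2r.
Qed.

(** Completeness, through real and imaginary parts, keeping the rate of
convergence. *)
Lemma complex_cauchy (u : nat -> R[i]) (e : nat -> R) :
  e @ \oo --> (0 : R) ->
  (forall m n, (m <= n)%N -> normc (u n - u m) <= e m) ->
  exists l, u @ \oo --> l /\ forall m, normc (l - u m) <= e m.
Proof.
move=> e0 ue.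
have cauchy_part (p : R[i] -> R) : {morph p : x y / x - y} ->
    (forall z, `|p z| <= normc z) -> cvgn (p \o u).
  move=> pB ple; apply/cauchy_cvgP/cauchy_exP => d d0.
  have /cvgrPdist_lt/(_ d d0) [N _ Ne] := e0.
  exists (p (u N)); exists N => // n /= Nn; rewrite /ball /=.
  rewrite distrC -pB (le_lt_trans (ple _)) // (le_lt_trans (ue _ _ Nn)) //.
  have := Ne N (leqnn N); rewrite /= sub0r normrN; apply: le_lt_trans.
  exact: ler_norm.
have /cvg_ex[a ua] : cvgn (@complex.Re R \o u).
  by apply: cauchy_part => [[? ?] [? ?]//|]; exact: Re_le_normc.
have /cvg_ex[b ub] : cvgn (@complex.Im R \o u).
  by apply: cauchy_part => [[? ?] [? ?]//|]; exact: Im_le_normc.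
have ul : u @ \oo --> (a +i* b : R[i]).
  apply/cvgn_normcP.
  have abs0 (v : nat -> R) (x : R) : v @ \oo --> x ->
      (fun n => `|v n - x|) @ \oo --> (0 : R).
    move=> vx; rewrite -[X in _ --> X](normr0 R) -(subrr x).
    by apply: cvg_norm; apply: cvgB => //; exact: cvg_cst.
  have ab0 : (fun n => `|complex.Re (u n) - a| + `|complex.Im (u n) - b|) @ \oo
      --> (0 : R).
    by rewrite -[X in _ --> X](addr0 0); apply: cvgD; exact: abs0.
  apply: cvgn_le0 ab0 => n; rewrite normc_ge0 /= (le_trans (normc_le_ReIm _)) //.
  by case: (u n).
exists (a +i* b); split => // m.
have lmE n : u n - u m - (a +i* b - u m) = u n - a +i* b by rewrite opprB subrKA.
apply: (@normc_lim_le (fun n => u n - u m) _ (fun=> e m)).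
- apply/cvgn_normcP; move/cvgn_normcP in ul.
  under eq_fun do rewrite lmE.
  exact: ul.
- exact: cvg_cst.
- by exists m => // n /= mn; exact: ue.
Qed.

End Modulus.

(** * Truncated Jost functions and tridiagonal determinants *)

Section Jost.
Variable F : comNzRingType.
Implicit Types (a b c al : nat -> F) (z : F).

(** The pair (f_m, f_(m+1)) of the backward Jost recurrence that starts from the
free values (1, 1) at m + k. *)
Fixpoint jost_pair b al z (k m : nat) : F * F :=
  if k is k'.+1 then
    let p := jost_pair b al z k' m.+1 in
    ((z ^+ 2 + 1 - z * b m.+1) * p.1 - al m.+1 * z ^+ 2 * p.2, p.1)
  else (1, 1).

(** The Jost function of the operator that is free beyond N; [al] stands for the
products a_m c_m. *)
Definition jost b al z N m : F := (jost_pair b al z (N - m) m).1.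

Lemma jost_free b al z N m : (N <= m)%N -> jost b al z N m = 1.
Proof. by rewrite /jost -subn_eq0 => /eqP ->. Qed.

Lemma jost_rec b al z N m : (m < N)%N ->
  jost b al z N m = (z ^+ 2 + 1 - z * b m.+1) * jost b al z N m.+1
                    - al m.+1 * z ^+ 2 * jost b al z N m.+2.
Proof.
move=> mN; rewrite /jost -(subnSK mN) /=; congr (_ - _ * _).
by case: (N - m.+1)%N (subnS N m.+1) => [|k] -> //.
Qed.

(** Rows and columns are numbered from 0, but the coefficient sequences from 1. *)
Definition tridiag a b c (i j : nat) : F :=
  (i == j)%:R * b i.+1 + (i.+1 == j)%:R * c i.+1 + (i == j.+1)%:R * a i.

Lemma tridiag_sub a b c i : tridiag a b c i.+1 i = a i.+1.
Proof.
rewrite /tridiag eqxx mul1r (gtn_eqF (ltnSn i)) (gtn_eqF (leqW (ltnSn i))).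
by rewrite !mul0r !add0r.
Qed.

Lemma tridiag_eq0 a b c i j : (i < j)%N -> tridiag a b c j.+1 i = 0.
Proof.
move=> ij; rewrite /tridiag eqSS (gtn_eqF ij) (gtn_eqF (leqW ij)).
by rewrite (gtn_eqF (leqW (leqW ij))) !mul0r !addr0.
Qed.

Definition tridiag_row a b c (u : nat -> F) (n : nat) : F :=
  (if n is m.+1 then a n * u m else 0) + b n.+1 * u n + c n.+1 * u n.+1.

(** The size n+1 section with the boundary condition u_(n+1) = z u_n built into
the last corner: on vectors of that kind it acts as the infinite matrix. *)
Definition corner_mx a b c z n : 'M[F]_n.+1 :=
  \matrix_(i, j) (tridiag a b c i j + ((i == n :> nat) && (j == n :> nat))%:R * (c n.+1 * z)).

Lemma sum_delta n (u : nat -> F) k :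
  \sum_(j < n) (k == j :> nat)%:R * u j = if (k < n)%N then u k else 0.
Proof.
case: ifP => kn; last first.
  rewrite big1 // => j _; rewrite [_ == _](_ : _ = false) ?mul0r //.
  by apply: contraFF kn => /eqP ->.
rewrite (bigD1 (Ordinal kn)) //= eqxx mul1r big1 ?addr0 // => j.
by rewrite -val_eqE /= eq_sym => /negPf ->; rewrite mul0r.
Qed.

Lemma corner_mx_row a b c z n (u : nat -> F) (i : 'I_n.+1) : u n.+1 = z * u n ->
  \sum_j corner_mx a b c z n i j * u j = tridiag_row a b c u i.
Proof.
move=> un.
under eq_bigr do rewrite mxE !mulrDl -!mulrA (mulrC (b _)) (mulrC (c _)) (mulrC (a _)) !mulrA.
rewrite !big_split /= -!mulr_suml !sum_delta ltn_ord.
rewrite /tridiag_row.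
have -> : \sum_(j < n.+1) (i == j.+1 :> nat)%:R * u j = if i : nat is m.+1 then u m else 0.
  case: (i : nat) (ltn_ord i) => [|m] mn; first by rewrite big1 // => j _; rewrite mul0r.
  by under eq_bigr do rewrite eqSS; rewrite sum_delta ltnW.
have -> : \sum_(j < n.+1) ((i == n :> nat) && (j == n :> nat))%:R * c n.+1 * z * u j
    = (i == n :> nat)%:R * c n.+1 * z * u n.
  under eq_bigr => j _ do rewrite (eq_sym (nat_of_ord j)) -mulnb natrM -!mulrA mulrCA.
  have := @sum_delta n.+1 (fun j => (i == n :> nat)%:R * (c n.+1 * (z * u j))) n.
  by rewrite ltnSn => ->; rewrite !mulrA.
have := ltn_ord i; rewrite ltnS leq_eqVlt => /orP[/eqP ->|iltn].
  by rewrite ltnn eqxx un mul0r addr0 mulr1n; case: (n) => [|m]; ring.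
rewrite ltnS iltn (ltn_eqF iltn) !mul0r addr0.
by case: (nat_of_ord i) => [|m]; ring.
Qed.

End Jost.

(** Replace the last column of the identity by the Jost solution psi and multiply
on the right: the last column of the product is -f_0 times the first basis
vector, since psi solves all the equations but the first, and removing it
together with the first row leaves a triangular matrix with diagonal a_1, ...,
a_n.  The hypothesis a_(n+1) = 1 makes the gauge factor p constant at the cut. *)
Lemma det_corner_mx (F : fieldType) (a b c : nat -> F) (z : F) (n : nat) :
  z != 0 -> (forall l, (0 < l)%N -> a l != 0) -> a n.+1 = 1 ->
  \det (corner_mx a (fun m => b m - (z + z^-1)) c z n) * z ^+ n.+1 =
  (-1) ^+ n.+1 * jost b (fun m => a m * c m) z n.+1 0.
Proof.
move=> z0 a0 an1; set M := corner_mx _ _ _ _ _.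
pose f := jost b (fun m => a m * c m) z n.+1.
pose p k := \prod_(1 <= l < k.+1) a l.
have pS k : p k.+1 = p k * a k.+1 by rewrite /p big_nat_recr.
have p0 : p 0%N = 1 by rewrite /p big_nil.
have fE m : (m <= n)%N -> f m = (z ^+ 2 + 1 - z * b m.+1) * f m.+1
                    - a m.+1 * c m.+1 * z ^+ 2 * f m.+2.
  by move=> mn; rewrite /f jost_rec.
(* z^m f_m solves the equation with subdiagonal 1 and superdiagonal a c; the
     factor p turns it into a solution for the given a and c. *)
pose psi j := z ^+ j.+1 * f j.+1 * p j.
pose U : 'M[F]_n.+1 := \matrix_(i, j) (if j == ord_max then psi i else (i == j)%:R).
have detU : \det U = z ^+ n.+1 * p n.
  rewrite -det_tr det_trig; last first.
    apply/is_trig_mxP => i j ij; rewrite !mxE ifN; last first.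
      by apply: contraTneq ij => ->; rewrite -leqNgt leq_ord.
    by rewrite eqE /= gtn_eqF.
  rewrite big_ord_recr /= !mxE eqxx /psi /f jost_free // mulr1 big1 ?mul1r // => i _.
  by rewrite !mxE ifN ?eqxx // -val_eqE /= ltn_eqF.
have MU i : (M *m U) i ord_max = - (f 0%N *+ (i == ord0)).
  rewrite mxE; under eq_bigr do rewrite [U _ _]mxE eqxx.
  rewrite (@corner_mx_row _ _ _ _ _ _ psi); last first.
    by rewrite /psi /f !jost_free // pS an1 exprS; ring.
  rewrite /tridiag_row /psi; case: i => -[|i] //= ilt.
    by rewrite pS p0 (fE 0%N) //; field.
  by rewrite oppr0 !pS (fE i.+1) // !exprS; field.
have : \det (M *m U) = - f 0%N * ((-1) ^+ n * p n).
  rewrite (expand_det_col _ ord_max) (bigD1 ord0) //= big1 ?addr0; last first.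
    by move=> i /negPf i0; rewrite MU i0 oppr0 mul0r.
  rewrite MU mulr1n; congr (_ * _); rewrite /cofactor /= add0n; congr (_ * _).
  have subE (i j : 'I_n) : row' ord0 (col' ord_max (M *m U)) i j =
      tridiag a (fun m => b m - (z + z^-1)) c i.+1 j.
    rewrite !mxE (bigD1 (lift ord_max j)) //= big1 ?addr0 => [|k /negPf kj].
      rewrite !mxE [lift _ _ == ord_max]eq_sym (negPf (neq_lift _ _)) eqxx mulr1.
      rewrite !lift_max lift0.
      by rewrite (ltn_eqF (ltn_ord j)) andbF mul0r addr0.
    by rewrite !mxE [lift _ _ == ord_max]eq_sym (negPf (neq_lift _ _)) kj mulr0.
  rewrite -det_tr det_trig.
    rewrite /p big_add1 /= big_mkord; apply: eq_bigr => i _.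
    by rewrite mxE subE tridiag_sub.
  by apply/is_trig_mxP => i j ij; rewrite mxE subE tridiag_eq0.
rewrite det_mulmx detU => detE.
have pn0 : p n != 0.
  rewrite /p prodf_seq_neq0; apply/allP => l; rewrite mem_index_iota => /andP[l0 _].
  exact: a0.
apply: (mulIf pn0); rewrite -mulrA detE exprS; ring.
Qed.

(** * Volterra equation and Gronwall estimates *)

Section JostUniq.
Variable F : comNzRingType.
Implicit Types (b al : nat -> F) (z : F).

Lemma jost_uniq b al z N (g : nat -> F) :
  (forall m, (N <= m)%N -> g m = 1) ->
  (forall m, (m < N)%N -> g m = (z ^+ 2 + 1 - z * b m.+1) * g m.+1
                                - al m.+1 * z ^+ 2 * g m.+2) ->
  jost b al z N =1 g.
Proof.
move=> gfree grec m; have [k] := ubnP (N - m); elim: k m => // k IH m mk.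
have [Nm|mN] := leqP N m; first by rewrite jost_free ?gfree.
rewrite jost_rec // grec // !IH //; move: mk; rewrite -(subnSK mN) !ltnS => //.
by apply: leq_ltn_trans; apply: leq_sub2l.
Qed.

(** Lets Jost functions cut at different places be compared as Jost functions
with the same cut and different coefficients. *)
Lemma jost_trunc b al z n N : (n <= N)%N ->
  jost (fun s => if (s <= n)%N then b s else 0)
       (fun s => if (s <= n)%N then al s else 1) z N =1 jost b al z n.
Proof.
move=> nN; apply: jost_uniq => m mN; first by rewrite jost_free // (leq_trans nN).
have [nm|mn] := leqP n m; last by rewrite jost_rec.
by rewrite !jost_free ?mulr0 ?subr0 ?mulr1 ?mul1r ?addrK ?(addrC _ 1) ?addrK // leqW // leqW.
Qed.

(** z * geo z k is the free Volterra kernel (z^(-k) - z^k) z^k / (z^(-1) - z),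
written without division so that it makes sense at z = 0 and z = 1, -1. *)
Definition geo z k := \sum_(i < k) (z ^+ 2) ^+ i.

(** Variation of constants.  Telescoping f_m from m upwards, the increments being
geometric with ratio z^2 up to the source term r, collects the geometric sums. *)
Lemma volterra z N (f r : nat -> F) :
  f N = f N.+1 ->
  (forall m, (m < N)%N -> f m - f m.+1 = z ^+ 2 * (f m.+1 - f m.+2) + z * r m.+1) ->
  forall m, (m <= N)%N ->
  f m = f N + \sum_(m <= j < N) z * geo z (j.+1 - m) * r j.+1.
Proof.
move=> fN frec m mN.
have step t : (m + t <= N)%N -> f m = f (m + t)%N +
    (geo z t.+1 - 1) * (f (m + t)%N - f (m + t).+1) +
    \sum_(0 <= j < t) z * geo z j.+1 * r (j + m).+1.
  elim: t => [|t IH] mtN.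
    by rewrite addn0 big_geq // /geo big_ord1 expr0 subrr mul0r !addr0.
  have mtN' : (m + t < N)%N by rewrite -addnS.
  rewrite IH 1?ltnW // big_nat_recr //= addnS (addnC t m).
  have -> : geo z t.+2 = 1 + z ^+ 2 * geo z t.+1.
    rewrite /geo big_ord_recl expr0 mulr_sumr; congr (_ + _).
    by apply: eq_bigr => i _; rewrite -exprS.
  have := frec _ mtN'; set u := f (m + t)%N; set v := f (m + t).+1.
  set w := f (m + t).+2; set S := \sum_(_ <= _ < _) _ => uv.
  have -> : u = v + (z ^+ 2 * (v - w) + z * r (m + t).+1) by rewrite -uv addrC subrK.
  ring.
rewrite (step (N - m)%N) subnKC // -fN subrr mulr0 addr0; congr (_ + _).
rewrite -[X in _ = \sum_(X <= _ < _) _]add0n big_addn; apply: eq_bigr => j _.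
by rewrite -addSn addnK.
Qed.

End JostUniq.

Section Gronwall.
Variable R : realType.

(** The majorant y_m on the right satisfies y_m <= (1 + p_(m+1) + q_(m+1)) y_(m+1)
because it is nonincreasing in m and dominates x. *)
Lemma gronwall (A : R) (N : nat) (p q x : nat -> R) :
  0 <= A -> (forall j, 0 <= p j) -> (forall j, 0 <= q j) -> (forall m, 0 <= x m) ->
  (forall m, x m <= A + \sum_(m <= j < N) (p j.+1 * x j.+1 + q j.+1 * x j.+2)) ->
  forall m, x m <= A * expR (\sum_(m <= j < N) (p j.+1 + q j.+1)).
Proof.
move=> A0 p0 q0 x0 xle m; apply: le_trans (xle m) _.
set y := fun m => A + \sum_(m <= j < N) (p j.+1 * x j.+1 + q j.+1 * x j.+2).
rewrite -/(y m).
have ySle k : y k.+1 <= y k.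
  have [kN|Nk] := ltnP k N; last by rewrite /y !big_geq // leqW.
  by rewrite lerD2l [leRHS]big_ltn // lerDr addr_ge0 // mulr_ge0.
have [k] := ubnP (N - m); elim: k m => // k IH m mk.
have [Nm|mN] := leqP N m; first by rewrite /y !big_geq // addr0 expR0 mulr1.
have -> : y m = p m.+1 * x m.+1 + q m.+1 * x m.+2 + y m.+1.
  by rewrite /y big_ltn // addrCA.
have ym : y m.+1 <= A * expR (\sum_(m.+1 <= j < N) (p j.+1 + q j.+1)).
  by apply: IH; move: mk; rewrite -(subnSK mN) !ltnS.
rewrite [in leRHS]big_ltn // expRD mulrCA.
apply: (@le_trans _ _ ((1 + (p m.+1 + q m.+1)) * y m.+1)).
  rewrite mulrDl mul1r addrC lerD2l mulrDl lerD // ler_wpM2l //.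
  exact: le_trans (xle _) (ySle _).
apply: ler_pM => //; last exact: expR_ge1Dx.
- by rewrite addr_ge0 // addr_ge0.
- exact: le_trans (x0 _) (xle _).
Qed.

End Gronwall.

(** The kernel bound kappa is kept abstract: the two estimates of the theorem come
from two choices of it. *)
Section JostBounds.
Variables (R : realType) (z : R[i]) (kappa : nat -> R).
Hypothesis z_le1 : normc z <= 1.
Hypothesis kappa_bound : forall s k, (0 < k <= s)%N -> normc (z * geo z k) <= kappa s.
Implicit Types b al : nat -> R[i].

Lemma kappa_ge0 s : 0 <= kappa s.+1.
Proof. by apply: le_trans (normc_ge0 _) (kappa_bound (k := 1) _). Qed.

Definition free_dist b al s := normc (b s) + normc (1 - al s).

Lemma free_dist_ge0 b al s : 0 <= free_dist b al s.
Proof. by rewrite addr_ge0 ?normc_ge0. Qed.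

Definition jost_exponent b al N := \sum_(0 <= j < N) kappa j.+1 * free_dist b al j.+1.

(** With a source term e, so that it applies both to a Jost function (e = 0) and
to the difference of two of them. *)
Lemma volterra_bound b al N (f e : nat -> R[i]) (A : R) :
  (forall m, (N <= m)%N -> normc (f m) <= A) -> f N = f N.+1 ->
  (forall m, (m < N)%N -> f m = (z ^+ 2 + 1 - z * b m.+1) * f m.+1
                                - al m.+1 * z ^+ 2 * f m.+2 + z * e m.+1) ->
  normc (f N) + \sum_(0 <= j < N) kappa j.+1 * normc (e j.+1) <= A ->
  forall m, normc (f m) <= A * expR (jost_exponent b al N).
Proof.
move=> ftail fN frec fA m.
have A0 : 0 <= A.
  apply: le_trans fA; rewrite addr_ge0 ?normc_ge0 // sumr_ge0 // => j _.
  by rewrite mulr_ge0 ?kappa_ge0 ?normc_ge0.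
pose r s := - b s * f s + (1 - al s) * z * f s.+1 + e s.
have V := volterra (r := r) fN.
have {V} V k : (k <= N)%N ->
    f k = f N + \sum_(k <= j < N) z * geo z (j.+1 - k) * r j.+1.
  by apply: V => {k} k kN; rewrite [f k]frec // /r; ring.
pose p j := normc (b j) * if j is 0%N then 0 else kappa j.
pose q j := normc (1 - al j) * if j is 0%N then 0 else kappa j.
have k0 j : 0 <= if j is 0%N then 0 else kappa j.
  by case: j => // j; exact: kappa_ge0.
have xle k : normc (f k) <=
    A + \sum_(k <= j < N) (p j.+1 * normc (f j.+1) + q j.+1 * normc (f j.+2)).
  have [Nk|kN] := leqP N k; first by rewrite big_geq // addr0 ftail.
  rewrite V 1?ltnW // (le_trans (le_normcD _ _)) //.
  apply: (@le_trans _ _ (normc (f N) + \sum_(k <= j < N) kappa j.+1 * normc (e j.+1)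
     + \sum_(k <= j < N) (p j.+1 * normc (f j.+1) + q j.+1 * normc (f j.+2)))).
    rewrite -addrA lerD2l -big_split /= (le_trans (normc_sum _ _ _)) //.
    rewrite !big_nat; apply: ler_sum => j /andP[kj jN].
    rewrite normcM (@le_trans _ _ (kappa j.+1 * normc (r j.+1))) //.
      rewrite ler_wpM2r ?normc_ge0 // kappa_bound // subn_gt0 ltnS kj /=.
      by rewrite leq_subr.
    rewrite /p /q /= !(mulrAC _ (kappa _)) -mulrDl [X in _ + X]mulrC -mulrDr.
    rewrite ler_wpM2l ?kappa_ge0 // /r addrC (le_trans (le_normcD _ _)) // lerD2l.
    rewrite (le_trans (le_normcD _ _)) // !normcM normcN lerD2l.
    rewrite -mulrA ler_wpM2l ?normc_ge0 // ler_piMl ?normc_ge0 //.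
  rewrite lerD2r; apply: le_trans fA; rewrite lerD2l.
  rewrite [leRHS](big_cat_nat (leq0n k) (ltnW kN)) /= lerDr sumr_ge0 // => j _.
  by rewrite mulr_ge0 ?kappa_ge0 ?normc_ge0.
apply: le_trans (gronwall A0 _ _ _ xle m) _ => //.
- by move=> j; rewrite mulr_ge0 ?normc_ge0.
- by move=> j; rewrite mulr_ge0 ?normc_ge0.
- by move=> j; exact: normc_ge0.
rewrite ler_wpM2l // ler_expR /jost_exponent.
have pqE j : p j.+1 + q j.+1 = kappa j.+1 * free_dist b al j.+1.
  by rewrite /p /q -mulrDl mulrC.
rewrite (eq_bigr _ (fun j _ => pqE j)).
have [Nm|mN] := leqP N m.
  rewrite big_geq // sumr_ge0 // => j _.
  by rewrite mulr_ge0 ?kappa_ge0 ?free_dist_ge0.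
rewrite [leRHS](big_cat_nat (leq0n m) (ltnW mN)) /= lerDr sumr_ge0 // => j _.
by rewrite mulr_ge0 ?kappa_ge0 ?free_dist_ge0.
Qed.

Lemma jost_bound b al N m : normc (jost b al z N m) <= expR (jost_exponent b al N).
Proof.
rewrite -[leRHS]mul1r; apply: (@volterra_bound _ _ _ _ (fun=> 0)).
- by move=> k Nk; rewrite jost_free // normc1.
- by rewrite !jost_free.
- by move=> k kN; rewrite mulr0 addr0 jost_rec.
- by rewrite jost_free // normc1 big1 ?addr0 // => j _; rewrite normc0 mulr0.
Qed.

(** The difference solves the first recurrence with a source term given by the
difference of the coefficients times the second solution. *)
Lemma jost_stability b al b' al' N m :
  normc (jost b al z N m - jost b' al' z N m) <=
  (\sum_(0 <= j < N) kappa j.+1 *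
     (normc (b j.+1 - b' j.+1) + normc (al j.+1 - al' j.+1)))
  * expR (jost_exponent b' al' N) * expR (jost_exponent b al N).
Proof.
set S := \sum_(_ <= _ < _) _.
pose f' := jost b' al' z N.
pose e s := (b' s - b s) * f' s + (al' s - al s) * z * f' s.+1.
have S0 : 0 <= S.
  by rewrite sumr_ge0 // => j _; rewrite mulr_ge0 ?kappa_ge0 ?addr_ge0 ?normc_ge0.
apply: (@volterra_bound _ _ _ (fun k => jost b al z N k - f' k) e).
- by move=> k Nk; rewrite /f' !jost_free // subrr normc0 mulr_ge0 ?expR_ge0.
- by rewrite /f' !jost_free.
- by move=> k kN; rewrite /e /f' !(jost_rec _ _ _ kN); ring.
rewrite /f' !jost_free // subrr normc0 add0r mulr_suml.
apply: ler_sum => j _; rewrite -mulrA ler_wpM2l ?kappa_ge0 //.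
rewrite (le_trans (le_normcD _ _)) // [leRHS]mulrDl lerD // !normcM.
  by rewrite normc_distC ler_wpM2l ?normc_ge0 // jost_bound.
rewrite normc_distC -mulrA ler_wpM2l ?normc_ge0 //.
apply: (@le_trans _ _ (1 * normc (f' j.+2))).
  by rewrite ler_wpM2r ?normc_ge0.
by rewrite mul1r jost_bound.
Qed.

End JostBounds.

(** * The resolvent of the free Jacobi operator *)

Section Ell2Norm.
Variable R : realType.
Implicit Types (x y : ell2 R) (u : nat -> R[i]).

Definition sqsum u N := \sum_(0 <= n < N) normc (u n) ^+ 2.

Lemma square_summable_bounded u (B : R) : (forall N, sqsum u N <= B) ->
  u \in @square_summable R.
Proof.
move=> uB; apply/asboolP; apply: cvg_nneg_series uB => n; exact: sqr_ge0.
Qed.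

Lemma l2norm_le x (B : R) : 0 <= B -> (forall N, sqsum x N <= B ^+ 2) -> l2norm x <= B.
Proof.
move=> B0 xB; rewrite /l2norm -[leRHS]ger0_norm // -sqrtr_sqr ler_wsqrtr //.
apply: limr_le; first by have /asboolP := ell2P x.
by apply: nearW => N; exact: xB.
Qed.

Lemma sqsum_le x N : sqsum x N <= l2norm x ^+ 2.
Proof.
have /asboolP xcvg := ell2P x.
have le N' := nneg_series_le_lim N' (fun n => sqr_ge0 (normc (x n))) xcvg.
rewrite sqr_sqrtr; first exact: le.
by apply: le_trans (le 0%N); rewrite /series /= big_geq.
Qed.

Lemma l2norm_ge0 x : 0 <= l2norm x.
Proof. exact: sqrtr_ge0. Qed.

Lemma coord_le x n : normc (x n) <= l2norm x.
Proof.
rewrite -ler_sqr ?nnegrE ?normc_ge0 ?l2norm_ge0 //.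
apply: le_trans (sqsum_le x n.+1); rewrite /sqsum big_nat_recr //= lerDr.
by apply: sumr_ge0 => *; exact: sqr_ge0.
Qed.

Lemma ell2_ext x y : (forall n, x n = y n) -> x = y.
Proof. by move=> xy; apply: val_inj; apply/funext. Qed.

Lemma ell2D x y n : (x + y) n = x n + y n. Proof. by []. Qed.
Lemma ell2B x y n : (x - y) n = x n - y n. Proof. by []. Qed.
Lemma ell2_lin k x y n : (k *: x + y) n = k * x n + y n. Proof. by []. Qed.
Lemma ell2Z k x n : (k *: x) n = k * x n. Proof. by []. Qed.

End Ell2Norm.

Section Resolvent.
Variables (R : realType) (z : R[i]).
Hypothesis (z_neq0 : z != 0) (z_lt1 : normc z < 1).
Implicit Types (x y : ell2 R) (u v : nat -> R[i]).
Let r := normc z.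

Let r_ge0 : 0 <= r. Proof. exact: normc_ge0. Qed.
Let r1_gt0 : 0 < 1 - r. Proof. by rewrite subr_gt0. Qed.

(** The inverse of 1 - z R, for R the forward shift. *)
Fixpoint geo_conv v n : R[i] := if n is m.+1 then v n + z * geo_conv v m else v 0%N.

Definition free_minus_row u n := tridiag_row (fun=> 1) (fun=> - (z + z^-1)) (fun=> 1) u n.

(** The factorization -z (J0 - lambda) = (1 - z L)(1 - z R), which holds because
L R = 1. *)
Lemma free_minus_factor v n :
  free_minus_row (fun k => - z * geo_conv v k) n = v n - z * v n.+1.
Proof.
rewrite /free_minus_row /tridiag_row; case: n => [|n] /=; by field.
Qed.

(** Convexity of the square for the weights 1 - r and r: this is what makes the
two shift inverses bounded on l2 without taking square roots of sums. *)
Lemma sqr_convex (s t : R) : (s + r * t) ^+ 2 <= (1 - r)^-1 * s ^+ 2 + r * t ^+ 2.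
Proof.
have -> : (1 - r)^-1 * s ^+ 2 + r * t ^+ 2 =
    (s + r * t) ^+ 2 + r / (1 - r) * (s - (1 - r) * t) ^+ 2.
  by field; rewrite gt_eqF.
by rewrite lerDl mulr_ge0 ?sqr_ge0 // divr_ge0 // ltW.
Qed.

Lemma normc_affine_sqr (a b : R[i]) :
  normc (a + z * b) ^+ 2 <= (1 - r)^-1 * normc a ^+ 2 + r * normc b ^+ 2.
Proof.
apply: le_trans (sqr_convex _ _); rewrite ler_sqr ?nnegrE ?addr_ge0 ?mulr_ge0 ?normc_ge0 //.
by rewrite (le_trans (le_normcD _ _)) // normcM.
Qed.

Lemma sqsum_geo_conv v N : sqsum (geo_conv v) N <= (1 - r)^-1 ^+ 2 * sqsum v N.
Proof.
have le1 M : sqsum (geo_conv v) M.+1 <=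
    (1 - r)^-1 * sqsum v M.+1 + r * sqsum (geo_conv v) M.
  elim: M => [|M IH].
    rewrite /sqsum !big_nat1 big_geq // mulr0 addr0 ler_peMl ?sqr_ge0 //.
    by rewrite invf_ge1 // lerBlDr lerDl.
  rewrite [leLHS]big_nat_recr //= [X in r * X]big_nat_recr //=.
  rewrite [X in _ * X + _]big_nat_recr //= !mulrDr addrACA lerD //.
  exact: normc_affine_sqr.
rewrite expr2 -mulrA -ler_pdivrMl ?invr_gt0 // invrK mulrBl mul1r lerBlDr.
case: N => [|N]; first by rewrite /sqsum !big_geq // !mulr0 addr0.
apply: le_trans (le1 N) _; rewrite lerD2l ler_wpM2l //.
by rewrite [leRHS]big_nat_recr //= lerDl sqr_ge0.
Qed.

Lemma geo_conv_summable v : v \in @square_summable R ->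
  geo_conv v \in @square_summable R.
Proof.
move=> vP; pose x := Ell2 vP.
apply: (square_summable_bounded (B := (1 - r)^-1 ^+ 2 * l2norm x ^+ 2)) => N.
apply: le_trans (sqsum_geo_conv _ _) _.
by rewrite ler_wpM2l ?sqr_ge0 // (sqsum_le x).
Qed.

Lemma cvg_geo (M : R) : (fun k => M * r ^+ k) @ \oo --> (0 : R).
Proof.
apply: (@cvg_geometric R M r); by rewrite ger0_norm.
Qed.

Lemma le0_geo (a M : R) : (forall k, a <= M * r ^+ k) -> a <= 0.
Proof.
move=> aM; have := cvg_geo M => gM.
rewrite -(cvg_lim _ gM) //; apply: limr_ge; first by apply/cvg_ex; exists 0.
by apply: nearW => k; exact: aM.
Qed.

(** The inverse of 1 - z L, for L the backward shift: y_n is the sum of the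
z^k x_(n+k). *)
Lemma back_conv x : exists y : nat -> R[i],
  (forall n, y n = x n + z * y n.+1) /\ (forall n, normc (y n) <= l2norm x / (1 - r)).
Proof.
set M := l2norm x.
have M0 : 0 <= M by exact: l2norm_ge0.
pose w n K := \sum_(0 <= k < K) z ^+ k * x (n + k)%N.
have geoB m K : (m <= K)%N -> \sum_(m <= k < K) M * r ^+ k <= M / (1 - r) * r ^+ m.
  move=> mK; rewrite -mulr_sumr -mulrA ler_wpM2l //.
  rewrite -[leLHS](mulKf (lt0r_neq0 r1_gt0)) ler_wpM2l ?invr_ge0 ?(ltW r1_gt0) //.
  rewrite mulr_sumr (eq_bigr (fun k => - (r ^+ k.+1 - r ^+ k))); last first.
    by move=> k _; rewrite exprS; ring.
  rewrite sumrN telescope_sumr //.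
  by rewrite opprB lerBlDr lerDl exprn_ge0.
have wC n : exists l, w n @ \oo --> l /\ forall m, normc (l - w n m) <= M / (1 - r) * r ^+ m.
  apply: complex_cauchy; first exact: cvg_geo.
  move=> m K mK; rewrite /w (big_cat_nat (leq0n m) mK) /= addrAC subrr add0r.
  apply: le_trans (normc_sum _ _ _) _; apply: le_trans (geoB m K mK).
  apply: ler_sum => k _; rewrite normcM normcX mulrC ler_wpM2r ?exprn_ge0 //.
  exact: coord_le.
have /choice[y yP] := wC.
exists y; split=> n; last first.
  by have := (yP n).2 0%N; rewrite /w big_geq // subr0 expr0 mulr1.
apply/eqP; rewrite -subr_eq0; apply/eqP/eq0_normc/le_anti; rewrite normc_ge0 andbT.
apply: (@le0_geo _ (M / (1 - r) * (r + r))) => k.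
have wS : w n k.+1 = x n + z * w n.+1 k.
  rewrite /w big_nat_recl //= expr0 mul1r addn0 mulr_sumr; congr (_ + _).
  by apply: eq_bigr => j _; rewrite exprS mulrA addnS addSn.
have -> : y n - (x n + z * y n.+1) = (y n - w n k.+1) - z * (y n.+1 - w n.+1 k).
  by rewrite wS; ring.
have -> : M / (1 - r) * (r + r) * r ^+ k =
    M / (1 - r) * r ^+ k.+1 + r * (M / (1 - r) * r ^+ k) by rewrite exprS; ring.
rewrite (le_trans (le_normcD _ _)) // normcN lerD ?(yP n).2 // normcM.
by rewrite ler_wpM2l // (yP n.+1).2.
Qed.

(** The boundary term at N, which has no counterpart for [geo_conv], is controlled
by the uniform bound on y. *)
Lemma sqsum_back_conv : exists2 B : R, 0 <= B & forall (x : ell2 R) (y : nat -> R[i]),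
  (forall n, y n = x n + z * y n.+1) ->
  (forall n, normc (y n) <= l2norm x / (1 - r)) ->
  forall N, sqsum y N <= (B * l2norm x) ^+ 2.
Proof.
pose C := (1 - r)^-1.
have C0 : 0 <= C by rewrite invr_ge0 ltW.
pose D := C * (C + r * C ^+ 2).
have D0 : 0 <= D by rewrite mulr_ge0 ?addr_ge0 ?mulr_ge0 ?sqr_ge0.
exists (Num.sqrt D); first exact: sqrtr_ge0.
move=> x y yE yB N; rewrite exprMn sqr_sqrtr // -mulrA.
rewrite -ler_pdivrMl ?invr_gt0 // invrK mulrBl mul1r lerBlDr.
have le1 : sqsum y N <= C * sqsum x N + r * (sqsum y N + normc (y N) ^+ 2).
  have -> : sqsum y N + normc (y N) ^+ 2 = normc (y 0%N) ^+ 2 +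
      \sum_(0 <= n < N) normc (y n.+1) ^+ 2.
    by rewrite -(big_nat_recl _ _ (fun n => normc (y n) ^+ 2)) //= big_nat_recr.
  apply: (@le_trans _ _ (C * sqsum x N + r * \sum_(0 <= n < N) normc (y n.+1) ^+ 2)).
    rewrite !mulr_sumr -big_split; apply: ler_sum => n _.
    by rewrite {1}yE normc_affine_sqr.
  by rewrite lerD2l ler_wpM2l // lerDr sqr_ge0.
apply: le_trans le1 _.
rewrite mulrDr addrCA addrC lerD2r mulrDl lerD //.
  by rewrite ler_wpM2l // sqsum_le.
rewrite -mulrA ler_wpM2l // -exprMn ler_sqr ?nnegrE ?normc_ge0 ?mulr_ge0 ?l2norm_ge0 //.
by rewrite mulrC yB.
Qed.

Lemma bounded_back_eq0 (v : nat -> R[i]) (B : R) :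
  (forall n, normc (v n) <= B) -> (forall n, v n = z * v n.+1) -> forall n, v n = 0.
Proof.
move=> vB vE n; apply/eq0_normc/le_anti; rewrite normc_ge0 andbT.
apply: (@le0_geo _ B) => k; elim: k n => [|k IH] n; first by rewrite expr0 mulr1.
by rewrite vE normcM exprS mulrCA ler_wpM2l.
Qed.

Definition free_minus x : ell2 R := jacobi_op (free_jacobi R) x - (z + z^-1) *: x.

Lemma free_minusE x n : free_minus x n = free_minus_row x n.
Proof.
rewrite /free_minus ell2B ell2Z /free_minus_row /tridiag_row /= /jacobi_fun /=.
by case: n => [|n]; ring.
Qed.

Lemma free_minus_linear : linear free_minus.
Proof.
move=> k x y; apply: ell2_ext => n.
rewrite ell2_lin !free_minusE /free_minus_row /tridiag_row.
by case: n => [|n]; rewrite !ell2_lin; ring.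
Qed.

(** A bounded kernel element of 1 - z L grows like z^(-n), so it vanishes; then
1 - z R is injective by induction from the first coordinate. *)
Lemma free_minus_inj : injective free_minus.
Proof.
move=> x x' xx'; apply: ell2_ext => n; apply/eqP; rewrite -subr_eq0 -ell2B; apply/eqP.
set u := x - x'.
have u0 k : free_minus_row u k = 0.
  rewrite -free_minusE.
  have -> : free_minus u = free_minus x - free_minus x'.
    by rewrite /u addrC -scaleN1r free_minus_linear scaleN1r addrC.
  by rewrite xx' subrr.
clearbody u.
pose v k := if k is m.+1 then u k - z * u m else u 0%N.
have uE k : u k = geo_conv v k by elim: k => //= k <-; rewrite subrK.
have v0 : forall k, v k = 0.
  apply: (@bounded_back_eq0 v (l2norm u + l2norm u)).
    move=> [|k] /=; first by rewrite (le_trans (coord_le _ _)) // lerDl l2norm_ge0.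
    rewrite (le_trans (le_normcD _ _)) // normcN lerD ?coord_le // normcM.
    by rewrite (le_trans _ (coord_le u k)) // ler_piMl ?normc_ge0 // ltW.
  move=> k; apply/eqP; rewrite -subr_eq0; apply/eqP.
  rewrite -free_minus_factor.
  have : - z * free_minus_row u k = 0 by rewrite u0 mulr0.
  move=> <-; rewrite /free_minus_row /tridiag_row -!uE.
  case: k => [|k]; rewrite -?uE; ring.
elim: n => [|k IH]; first exact: (v0 0%N).
by rewrite uE -[geo_conv v k.+1]/(v k.+1 + z * geo_conv v k) v0 -uE IH mulr0 addr0.
Qed.

Lemma free_minus_right_inverse : exists S : ell2 R -> ell2 R,
  (exists M : R, forall x, l2norm (S x) <= M * l2norm x) /\ cancel S free_minus.
Proof.
have [B B0 BP] := sqsum_back_conv.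
have C0 : 0 <= (1 - r)^-1 by rewrite invr_ge0 ltW.
pose M := (1 - r)^-1 * B.
have M0 : 0 <= M by rewrite mulr_ge0.
have /choice[S SP] (x : ell2 R) : exists s : ell2 R,
    l2norm s <= M * l2norm x /\ free_minus s = x.
  have [y [yE yB]] := back_conv x.
  pose s n := - z * geo_conv y n.
  have sB N : sqsum s N <= (M * l2norm x) ^+ 2.
    apply: (@le_trans _ _ (sqsum (geo_conv y) N)).
      apply: ler_sum => n _; rewrite /s normcM normcN exprMn ler_piMl ?sqr_ge0 //.
      by rewrite exprn_ile1 // ltW.
    apply: le_trans (sqsum_geo_conv _ _) _.
    rewrite /M -mulrA [leRHS]exprMn; apply: ler_wpM2l; first exact: sqr_ge0.
    exact: BP yE yB N.
  exists (Ell2 (square_summable_bounded sB)); split.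
    by apply: l2norm_le => //; rewrite mulr_ge0 ?l2norm_ge0.
  apply: ell2_ext => n; rewrite free_minusE free_minus_factor.
  by rewrite yE addrK.
exists S; split; first by exists M => x; exact: (SP x).1.
by move=> x; exact: (SP x).2.
Qed.

(** The operator is injective and has a bounded right inverse, so the description
that defines the resolvent is satisfied by some operator, and whichever one
is chosen is a left inverse. *)
Lemma resolventK : cancel free_minus (resolvent (jacobi_op (free_jacobi R)) (z + z^-1)).
Proof.
rewrite /resolvent /operator_inv.
have [S [SB SK]] := free_minus_right_inverse.
case: xgetP => [S' _ [_ //]|/(_ S)[]]; split.
- split=> // k x y; apply: free_minus_inj.
  by rewrite SK free_minus_linear !SK.
- by move=> x; apply: free_minus_inj; rewrite SK.
- exact: SK.
Qed.

(** -z times the two shift inverses applied to the basis vector j; the backward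
one produces the finite sequence z^j, ..., z, 1, 0, 0, ... *)
Definition green_fun j n : R[i] :=
  - z * geo_conv (fun k => if (k <= j)%N then z ^+ (j - k) else 0) n.

Lemma green_summable j : green_fun j \in @square_summable R.
Proof.
apply: (@square_summableZ _ (- z) (geo_conv _)); apply: geo_conv_summable.
by apply: (@square_summable_fin _ _ j.+1) => n jn; rewrite leqNgt jn.
Qed.

Definition green j : ell2 R := Ell2 (green_summable j).

Lemma free_minus_green j : free_minus (green j) = l2basis R j.
Proof.
apply: ell2_ext => n; rewrite free_minusE free_minus_factor /=.
have [nj|jn|->] := ltngtP n j.
- by rewrite -exprS subnSK // subrr.
- by rewrite mulr0 subrr.
- by rewrite subnn expr0 mulr0 subr0.
Qed.

(** The reason why finite sections of the resolvent are inverses of tridiagonal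
matrices with a modified corner. *)
Lemma green_tail j n : (j <= n)%N -> green j n.+1 = z * green j n.
Proof.
by move=> jn; rewrite /= /green_fun /= leqNgt ltnS jn /= add0r; ring.
Qed.

Lemma green_row_sum N n : \sum_(j < N) normc (green j n) <= (1 - r)^-1 ^+ 2.
Proof.
have C0 : 0 <= (1 - r)^-1 by rewrite invr_ge0 ltW.
have src k : \sum_(j < N) normc (if (k <= j)%N then z ^+ (j - k) else 0) <= (1 - r)^-1.
  apply: (@le_trans _ _ ((1 - r)^-1 * (1 - r ^+ (N - k)))); last first.
    by rewrite ler_piMr // lerBlDr lerDl exprn_ge0.
  elim: N => [|N IH]; first by rewrite big_ord0 subrr mulr0.
  rewrite big_ord_recr /=; apply: le_trans (lerD IH (lexx _)) _.
  case: leqP => [kN|Nk]; last first.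
    rewrite normc0 addr0 (eqP (Nk : (N.+1 - k)%N == 0%N)).
    by rewrite (eqP (ltnW Nk : (N - k)%N == 0%N)).
  rewrite subSn // exprS normcX le_eqVlt; apply/orP; left; apply/eqP.
  by field; rewrite gt_eqF.
rewrite /= /green_fun; under eq_bigr do rewrite normcM normcN.
rewrite -mulr_sumr; apply: (@le_trans _ _ (1 * (1 - r)^-1 ^+ 2)); last by rewrite mul1r.
apply: ler_pM => //; [by rewrite sumr_ge0 // => j _; exact: normc_ge0|exact: ltW|].
elim: n => [|n IH] /=.
  apply: le_trans (src 0%N) _; rewrite expr2 ler_peMl //.
  by rewrite invf_ge1 // lerBlDr lerDl.
apply: (@le_trans _ _ ((1 - r)^-1 + r * (1 - r)^-1 ^+ 2)).
  apply: le_trans (lerD (src n.+1) (ler_wpM2l r_ge0 IH)).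
  rewrite mulr_sumr -big_split; apply: ler_sum => j _.
  by rewrite (le_trans (le_normcD _ _)) // normcM.
by rewrite le_eqVlt; apply/orP; left; apply/eqP; field; rewrite gt_eqF.
Qed.

End Resolvent.

(** * Matrix entries of trace class operators *)

Section TraceClassEntries.
Variable R : realType.
Implicit Types (x y : ell2 R) (T : ell2 R -> ell2 R).

Lemma mul_conj_normc (w : R[i]) : w * w^* = (normc w ^+ 2)%:C.
Proof.
case: w => a b /=; rewrite sqr_sqrtr ?addr_ge0 ?sqr_ge0 //.
by simpc; congr (_ +i* _); ring.
Qed.

Lemma normc_conj (w : R[i]) : normc w^* = normc w.
Proof. by case: w => a b /=; rewrite sqrrN. Qed.

Lemma l2dot_basis y j : l2dot (l2basis R j) y = (y j)^*.
Proof.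
apply: complex_limn; apply/cvgn_normcP; apply: cvg_near_cst.
exists j.+1 => // n /= jn.
rewrite /series /= (bigD1_seq j) ?iota_uniq ?mem_index_iota //= eqxx mul1r.
rewrite big1 ?addr0 ?subrr ?normc0 // => k /negPf kj.
by rewrite kj mul0r.
Qed.

Lemma l2dot_self y : l2dot y y = (l2norm y ^+ 2)%:C.
Proof.
have /asboolP ycvg := ell2P y.
rewrite /l2norm sqr_sqrtr; last first.
  apply: limr_ge => //; apply: nearW => n; apply: sumr_ge0 => k _; exact: sqr_ge0.
apply: complex_limn; apply/cvgn_normcP.
set l := limn _.
have yl : (fun n => `|series (fun n => normc (y n) ^+ 2) n - l|) @ \oo --> (0 : R).
  rewrite -[X in _ --> X](normr0 R) -(subrr l).
  by apply: cvg_norm; apply: cvgB => //; exact: cvg_cst.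
apply: cvgn_le0 yl => n; rewrite normc_ge0 /=.
rewrite /series /=; under eq_bigr do rewrite mul_conj_normc.
by rewrite -rmorph_sum -rmorphB normc_real.
Qed.

Lemma orthonormal_sqsum (e : nat -> ell2 R) k N : orthonormal_seq e -> sqsum (e k) N <= 1.
Proof.
move=> /(_ k k); rewrite l2dot_self eqxx => /complexI e1.
by rewrite -e1; exact: sqsum_le.
Qed.

Lemma ell2_sum (n : nat) (g : nat -> ell2 R) i :
  (\sum_(k < n) g k : ell2 R) i = \sum_(k < n) g k i.
Proof. by elim: n => [|n IH]; rewrite ?big_ord0 // !big_ord_recr ell2D IH. Qed.

(** In the Schmidt expansion the entry (i + a, i + b) is the sum over k of
s_k f_k(i+a) times the conjugate of e_k(i+b).  By the inequality of the means
and the normalization of e_k and f_k, summing over i costs at most s_k. *)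
Lemma trace_class_diagonal_summable T (a b : nat) : trace_class T ->
  exists B : R, forall N, \sum_(0 <= i < N) normc (entry T (i + a) (i + b)) <= B.
Proof.
move=> [s [e [f [s0 eo fo scvg Tx]]]].
exists (limn (series s)) => N; apply/ler_addgt0Pr => eps eps0.
have part n : series s n <= limn (series s) by exact: nneg_series_le_lim.
pose err n i := l2norm (T (l2basis R (i + b)) -
  \sum_(k < n) ((s k)%:C * l2dot (l2basis R (i + b)) (e k)) *: f k).
have err0 : (fun n => \sum_(0 <= i < N) err n i) @ \oo --> (0 : R).
  have z0 : \sum_(0 <= i < N) (0 : R) = 0 by rewrite big1.
  rewrite -[X in _ --> X]z0.
  by apply: cvg_big => [|i _]; [exact: add_continuous|exact: Tx].
have /cvgrPdist_lt/(_ eps eps0) [n _ /(_ n (leqnn n))] := err0.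
rewrite /= sub0r normrN => errn.
have {}errn : \sum_(0 <= i < N) err n i <= eps by rewrite (le_trans (ler_norm _)) // ltW.
have entry_le i : normc (entry T (i + a) (i + b)) <=
    \sum_(0 <= k < n) s k *
      (2^-1 * (normc (e k (i + b)%N) ^+ 2 + normc (f k (i + a)%N) ^+ 2)) + err n i.
  set S := \sum_(k < n) ((s k)%:C * l2dot (l2basis R (i + b)) (e k)) *: f k.
  have -> : entry T (i + a) (i + b) = S (i + a)%N + (T (l2basis R (i + b)) - S) (i + a)%N.
    by rewrite ell2B subrKC.
  rewrite (le_trans (le_normcD _ _)) // lerD ?coord_le //.
  rewrite /S (ell2_sum n (fun k => ((s k)%:C * l2dot (l2basis R (i + b)) (e k)) *: f k)).
  rewrite big_mkord (le_trans (normc_sum _ _ _)) //; apply: ler_sum => k _.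
  rewrite ell2Z !normcM normc_real ger0_norm // -mulrA ler_wpM2l //.
  rewrite l2dot_basis normc_conj.
  set u := normc _; set v := normc _.
  rewrite -subr_ge0 (_ : _ - _ = 2^-1 * (u - v) ^+ 2); last by field.
  by rewrite mulr_ge0 ?invr_ge0 ?sqr_ge0.
apply: le_trans (ler_sum _ (fun i _ => entry_le i)) _.
rewrite big_split /= lerD //.
rewrite exchange_big /=; apply: le_trans (part n).
apply: ler_sum => k _; rewrite -mulr_sumr ler_piMr // -mulr_sumr big_split /=.
have shift_le (g : nat -> ell2 R) t : orthonormal_seq g ->
    \sum_(0 <= i < N) normc (g k (i + t)%N) ^+ 2 <= 1.
  move=> go; apply: le_trans (orthonormal_sqsum k (N + t) go).
  rewrite /sqsum (big_cat_nat (leq0n t) (leq_addl N t)) /=.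
  rewrite -[X in _ + \sum_(X <= _ < _) _]add0n big_addn addnK lerDr.
  by apply: sumr_ge0 => *; exact: sqr_ge0.
have := lerD (shift_le e b eo) (shift_le f a fo).
by move=> /(ler_wpM2l (ltW (_ : 0 < 2^-1 :> R))) /= /(_ _) /le_trans; apply; rewrite ?invr_gt0 //; lra.
Qed.

End TraceClassEntries.

(** * Fredholm determinants as limits of finite determinants *)

Section Fredholm.
Variable R : realType.

Lemma sum_ffun_widen (V : nmodType) (k n N : nat) (G : ('I_k -> nat) -> V) :
  (n <= N)%N ->
  \sum_(f : {ffun 'I_k -> 'I_n}) G (fun p => f p) =
  \sum_(f : {ffun 'I_k -> 'I_N} | [forall p, f p < n]%N) G (fun p => f p).
Proof.
move=> nN.
pose h (f : {ffun 'I_k -> 'I_n}) := [ffun p => widen_ord nN (f p)].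
have h_inj : injective h.
  move=> f g /ffunP fg; apply/ffunP => p; have := fg p; rewrite !ffunE.
  by move=> /(congr1 val) /= /val_inj.
rewrite (eq_bigl (fun f => f \in h @: [set: {ffun 'I_k -> 'I_n}])); last first.
  move=> f; apply/forallP/imsetP => [fn|[g _ -> p]]; last by rewrite ffunE /=.
  exists [ffun p => Ordinal (fn p)]; first by rewrite in_setT.
  apply/ffunP => p; rewrite !ffunE.
  exact: val_inj.
rewrite big_imset /=; last by move=> f g _ _; exact: h_inj.
rewrite [RHS](eq_bigl (fun=> true)); last by move=> f; rewrite in_setT.
apply: eq_bigr => f _; congr G; apply/funext => p; by rewrite ffunE.
Qed.

(** The terms of the difference of the two exponential series are nonnegative. *)
Lemma expR_partial_diff (a b : R) (K : nat) : 0 <= b <= a ->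
  \sum_(0 <= k < K) (k`!%:R)^-1 * (a ^+ k - b ^+ k) <= expR a - expR b.
Proof.
move=> /andP[b0 ba].
pose u := series (exp_coeff a) - series (exp_coeff b).
have uE n : u n = \sum_(0 <= k < n) (k`!%:R)^-1 * (a ^+ k - b ^+ k).
  have -> : u n = series (exp_coeff a) n - series (exp_coeff b) n by [].
  rewrite /series /= -sumrB; apply: eq_bigr => k _.
  by rewrite mulrBr mulrC [in RHS](mulrC _ (b ^+ k)).
have ucvg : u @ \oo --> expR a - expR b.
  by apply: cvgB; exact: is_cvg_series_exp_coeff.
have uincr : nondecreasing_seq u.
  apply/nondecreasing_seqP => n; rewrite !uE big_nat_recr //= lerDl.
  by rewrite mulr_ge0 ?invr_ge0 // subr_ge0 lerXn2r ?nnegrE // (le_trans b0).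
rewrite -uE -(cvg_lim _ ucvg) //; apply: nondecreasing_cvgn_le => //.
by apply/cvg_ex; exists (expR a - expR b).
Qed.

Variables (t : nat -> nat -> R[i]) (rho : nat -> R) (B : R).
Hypothesis rho_ge0 : forall i, 0 <= rho i.
Hypothesis t_rho : forall N i, \sum_(j < N) normc (t i j) <= rho i.
Hypothesis rho_B : forall N, \sum_(0 <= i < N) rho i <= B.

Let P := series rho.

Let P_ge0 n : 0 <= P n.
Proof. exact: sumr_ge0. Qed.

Let P_cvg : cvgn P.
Proof. exact: cvg_nneg_series rho_B. Qed.

Let Poo := limn P.

Let P_le n : P n <= Poo.
Proof. exact: nneg_series_le_lim. Qed.

Definition minor_sum k n : R[i] := (k`!%:R)^-1 *
  \sum_(f : {ffun 'I_k -> 'I_n}) \det (\matrix_(p, q) t (f p) (f q)).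

Lemma minor_le k N (f : {ffun 'I_k -> 'I_N}) :
  normc (\det (\matrix_(p, q) t (f p) (f q))) <= \prod_p rho (f p).
Proof.
have [f_inj|/negPf fN] := boolP (injectiveb f); last first.
  rewrite (_ : \det _ = 0) ?normc0 ?prodr_ge0 //.
  have := @det_not_inj _ N k (\matrix_(i, j) t i j) f; rewrite fN => /(_ isT) <-.
  by congr (\det _); apply/matrixP => p q; rewrite !mxE.
apply: le_trans (normc_det_le _) _; apply: ler_prod => p _.
rewrite sumr_ge0 /= => [|q _]; last exact: normc_ge0.
apply: le_trans (t_rho N _).
under eq_bigr do rewrite mxE.
rewrite -(@big_imset _ _ _ _ _ f predT (fun j => normc (t (f p) j))); last first.
  by move=> q r _ _; exact: (injectiveP _ f_inj).
rewrite [leRHS](bigID (fun j => j \in f @: predT)) /= lerDl sumr_ge0 // => j _.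
exact: normc_ge0.
Qed.

(** Both sides are sums over the tuples below N that are not below n, since the
products of the rho over all tuples sum up to a power of the partial sum of
rho; they are compared term by term by [minor_le]. *)
Lemma minor_sum_diff k n N : (n <= N)%N ->
  normc (minor_sum k N - minor_sum k n) <= (k`!%:R)^-1 * (P N ^+ k - P n ^+ k).
Proof.
move=> nN; rewrite /minor_sum -mulrBr normcM normcV normc_nat.
rewrite ler_wpM2l ?invr_ge0 //.
have PX M : P M ^+ k = \sum_(f : {ffun 'I_k -> 'I_M}) \prod_p rho (f p).
  rewrite -(bigA_distr_bigA (fun (p : 'I_k) (i : 'I_M) => rho i)) /= prodr_const card_ord.
  by rewrite /P /series /= big_mkord.
rewrite !PX.
rewrite (sum_ffun_widen (fun f => \det (\matrix_(p, q) t (f p) (f q))) nN).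
rewrite (sum_ffun_widen (fun f => \prod_p rho (f p)) nN).
rewrite (bigID (fun f : {ffun 'I_k -> 'I_N} => [forall p, f p < n]%N)) /= addrAC subrr add0r.
rewrite [X in _ <= X - _](bigID (fun f : {ffun 'I_k -> 'I_N} => [forall p, f p < n]%N)) /=.
rewrite [X in _ <= X]addrAC subrr add0r.
by apply: le_trans (normc_sum _ _ _) _; apply: ler_sum => f _; exact: minor_le.
Qed.

(** Let P be the sum of the rho and P_n its partial sums.  The bound
(P^k - P_n^k) / k! for the tail of the k-th term is summable in k,
with sum at most exp P - exp P_n.  This single quantity controls both the
convergence of the Fredholm series and its distance to the finite
determinants. *)
Lemma fredholm_cvg (T : ell2 R -> ell2 R) : (forall i j, entry T i j = t i j) ->
  (fun n => \det (1%:M + \matrix_(i < n, j < n) t i j)) @ \oo --> fredholm_det T.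
Proof.
move=> Tt.
have PX k : (fun m => (k`!%:R)^-1 * (Poo ^+ k - P m ^+ k)) @ \oo --> (0 : R).
  rewrite -[X in _ --> X](mulr0 (k`!%:R)^-1) -(subrr (Poo ^+ k)).
  apply: cvgMr; apply: cvgB; first exact: cvg_cst.
  exact: (continuous_cvg _ (@exprn_continuous R k Poo) P_cvg).
have Ek k : exists l, minor_sum k @ \oo --> l /\
    forall m, normc (l - minor_sum k m) <= (k`!%:R)^-1 * (Poo ^+ k - P m ^+ k).
  apply: complex_cauchy (PX k) _ => m n mn.
  apply: le_trans (minor_sum_diff k mn) _.
  by rewrite ler_wpM2l ?invr_ge0 // lerB // lerXn2r ?nnegrE // (le_trans (P_ge0 n)).
have /choice[E EP] := Ek.
have extE k : trace_ext T k = E k.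
  apply: complex_limn; have [+ _] := EP k; rewrite /minor_sum.
  set u := (fun n => _); set v := (fun n => _); suff -> : u = v by [].
  apply/funext => n; congr (_ * _); apply: eq_bigr => f _; congr (\det _).
  by apply/matrixP => p q; rewrite !mxE Tt.
pose D n := \det (1%:M + \matrix_(i < n, j < n) t i j).
pose s K := \sum_(0 <= k < K) E k.
pose delta n := expR Poo - expR (P n).
have sD n K : (n < K)%N -> normc (s K - D n) <= delta n.
  move=> nK; rewrite /D (det_1D_minors _ nK).
  apply: le_trans (expR_partial_diff K (_ : 0 <= P n <= Poo)); last by rewrite P_ge0 P_le.
  rewrite big_mkord /s big_mkord -sumrB; apply: le_trans (normc_sum _ _ _) _.
  apply: ler_sum => k _; have [_ /(_ n)] := EP k; rewrite /minor_sum.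
  set u := \sum_(f : {ffun _ -> _}) _; set v := \sum_(f : {ffun _ -> _}) _.
  suff -> : u = v by [].
  apply: eq_bigr => f _; congr (\det _); by apply/matrixP => p q; rewrite !mxE.
have delta0 : delta @ \oo --> (0 : R).
  rewrite -[X in _ --> X](subrr (expR Poo)); apply: cvgB; first exact: cvg_cst.
  exact: (continuous_cvg _ (@continuous_expR R Poo) P_cvg).
have cst_delta0 c : (fun n => c * delta n) @ \oo --> (0 : R).
  by rewrite -[X in _ --> X](mulr0 c); exact: cvgMr.
have [L [sL Ls]] : exists L, (fun n => s n.+1) @ \oo --> L /\
    forall m, normc (L - s m.+1) <= 2 * delta m.
  apply: complex_cauchy => // m n mn.
  have -> : s n.+1 - s m.+1 = (s n.+1 - D m) - (s m.+1 - D m) by rewrite opprB subrKA.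
  rewrite (le_trans (le_normcD _ _)) // normcN mulrDl mul1r lerD // sD //.
have detL : fredholm_det T = L.
  apply: complex_limn; rewrite -cvg_shiftS /=.
  rewrite (_ : (fun n => _) = (fun n => s n.+1)) //.
  by apply/funext => n; rewrite /series /= /s; apply: eq_bigr => k _; rewrite extE.
rewrite detL; apply/cvgn_normcP; apply: cvgn_le0 (cst_delta0 3) => n.
rewrite normc_ge0 /= -/(D n) normc_distC.
have -> : L - D n = (L - s n.+1) + (s n.+1 - D n) by rewrite subrKA.
have -> : 3 * delta n = 2 * delta n + delta n by ring.
by rewrite (le_trans (le_normcD _ _)) // lerD // sD.
Qed.

End Fredholm.

(** * The perturbation determinant as a limit of Jost functions *)

Section PerturbationDeterminant.
Variables (R : realType) (J : jacobi R) (z : R[i]).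
Hypothesis hJ : trace_class (jacobi_perturbation J).

Definition row_size i : R :=
  (if i is 0%N then 0 else normc (ja J i - 1)) + normc (jb J i.+1) + normc (jc J i.+1 - 1).

Lemma jacobi_perturbationE (u : ell2 R) i :
  jacobi_perturbation J u i =
  tridiag_row (fun m => ja J m - 1) (jb J) (fun m => jc J m - 1) u i.
Proof.
rewrite /jacobi_perturbation ell2B /tridiag_row /= /jacobi_fun /=.
by case: i => [|i]; ring.
Qed.

Lemma perturbation_summable : exists B : R, forall N,
  [/\ \sum_(0 <= i < N) normc (ja J i.+1 - 1) <= B,
      \sum_(0 <= i < N) normc (jb J i.+1) <= B &
      \sum_(0 <= i < N) normc (jc J i.+1 - 1) <= B].
Proof.
have basisE (i j : nat) : l2basis R j i = (i == j)%:R by [].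
have Ea i : entry (jacobi_perturbation J) (i + 1) (i + 0) = ja J i.+1 - 1.
  rewrite /entry jacobi_perturbationE addn0 addn1 /tridiag_row !basisE.
  by rewrite eqxx !gtn_eqF // mulr1 !mulr0 !addr0.
have Eb i : entry (jacobi_perturbation J) (i + 0) (i + 0) = jb J i.+1.
  rewrite /entry jacobi_perturbationE addn0 /tridiag_row; case: i => [|i].
    by rewrite !basisE /= mulr1 mulr0 add0r addr0.
  by rewrite !basisE eqxx (ltn_eqF (ltnSn i)) (gtn_eqF (ltnSn i.+1)) mulr1 !mulr0 add0r addr0.
have Ec i : entry (jacobi_perturbation J) (i + 0) (i + 1) = jc J i.+1 - 1.
  rewrite /entry jacobi_perturbationE addn0 addn1 /tridiag_row; case: i => [|i].
    by rewrite !basisE /= mulr1 mulr0 !add0r.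
  by rewrite !basisE eqxx !ltn_eqF // mulr1 !mulr0 !add0r.
have [Ba HBa] := trace_class_diagonal_summable 1 0 hJ.
have [Bb HBb] := trace_class_diagonal_summable 0 0 hJ.
have [Bc HBc] := trace_class_diagonal_summable 0 1 hJ.
exists (Num.max Ba (Num.max Bb Bc)) => N; rewrite !le_max.
split; apply/orP.
- by left; have := HBa N; under eq_bigr do rewrite Ea.
- by right; apply/orP; left; have := HBb N; under eq_bigr do rewrite Eb.
- by right; apply/orP; right; have := HBc N; under eq_bigr do rewrite Ec.
Qed.

Hypotheses (z0 : z != 0) (z1 : normc z < 1).

Definition kernel_entry i j : R[i] :=
  tridiag_row (fun m => ja J m - 1) (jb J) (fun m => jc J m - 1) (green z1 j) i.

Lemma entry_perturbation i j :
  entry (jacobi_perturbation J \o resolvent (jacobi_op (free_jacobi R)) (z + z^-1)) i j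
  = kernel_entry i j.
Proof.
rewrite /entry /comp -(free_minus_green z0 z1) resolventK //.
exact: jacobi_perturbationE.
Qed.

Lemma kernel_row_sum N i :
  \sum_(j < N) normc (kernel_entry i j) <= row_size i * (1 - normc z)^-1 ^+ 2.
Proof.
set C := _ ^+ 2.
apply: (@le_trans _ _ (\sum_(j < N) (
   (if i is m.+1 then normc (ja J i - 1) * normc (green z1 j m) else 0)
   + normc (jb J i.+1) * normc (green z1 j i)
   + normc (jc J i.+1 - 1) * normc (green z1 j i.+1)))).
  apply: ler_sum => j _; rewrite /kernel_entry /tridiag_row -!normcM.
  rewrite (le_trans (le_normcD _ _)) // lerD2r (le_trans (le_normcD _ _)) // lerD2r.
  by case: i => [|m]; rewrite ?normc0 // -normcM.
rewrite !big_split /= /row_size !mulrDl -!mulr_sumr !lerD //.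
- case: i => [|m]; first by rewrite big1 ?mul0r.
  by rewrite -mulr_sumr ler_wpM2l ?normc_ge0 // green_row_sum.
- by rewrite ler_wpM2l ?normc_ge0 // green_row_sum.
- by rewrite ler_wpM2l ?normc_ge0 // green_row_sum.
Qed.

Lemma row_size_summable : exists B : R, forall N, \sum_(0 <= i < N) row_size i <= B.
Proof.
have [B BP] := perturbation_summable.
exists (B + B + B) => N; have [Ba Bb Bc] := BP N.
rewrite /row_size !big_split /= !lerD //.
case: N {BP Bb Bc} Ba => [|N] Ba; first by move: Ba; rewrite !big_geq.
rewrite big_nat_recl //= add0r; apply: le_trans Ba.
by rewrite big_nat_recr //= lerDl normc_ge0.
Qed.

(** The products a_m c_m seen by the section of size n + 1: the entry a_(n+1) lies
in the first row that is cut off, so it keeps its free value. *)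
Definition cut_prod n m := (if m == n.+1 then 1 else ja J m) * jc J m.

Lemma perturbation_det_cvg :
  (fun n => \det (1%:M + \matrix_(i < n, j < n) kernel_entry i j)) @ \oo -->
  perturbation_det J (z + z^-1).
Proof.
have [B BP] := row_size_summable.
pose C := (1 - normc z)^-1 ^+ 2.
have C0 : 0 <= C by exact: sqr_ge0.
apply: (@fredholm_cvg _ _ (fun i => row_size i * C) (B * C)).
- move=> i; rewrite mulr_ge0 // !addr_ge0 ?normc_ge0 //.
  by case: i => // i; exact: normc_ge0.
- exact: kernel_row_sum.
- by move=> N; rewrite -mulr_suml ler_wpM2r.
- exact: entry_perturbation.
Qed.

(** With G the section of the free resolvent, A0 its tridiagonal inverse and D' the
section of J - J0 with the same boundary condition, 1 + D' G equals
(A0 + D') A0^(-1), a quotient of two determinants covered by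
[det_corner_mx]. *)
Lemma det_kernel n :
  \det (1%:M + \matrix_(i < n.+1, j < n.+1) kernel_entry i j) =
  jost (jb J) (cut_prod n) z n.+1 0.
Proof.
pose ja' m := if m == n.+1 then 1 else ja J m.
pose A0 := corner_mx (fun=> 1) (fun=> 0 - (z + z^-1)) (fun=> 1) z n.
pose D' := corner_mx (fun m => ja' m - 1) (jb J) (fun m => jc J m - 1) z n.
pose G : 'M[R[i]]_n.+1 := \matrix_(i, j) green z1 j i.
have green_last (j : 'I_n.+1) : green z1 j n.+1 = z * green z1 j n.
  by apply: green_tail; rewrite -ltnS ltn_ord.
have A0G : A0 *m G = 1%:M.
  apply/matrixP => i j; rewrite mxE; under eq_bigr do rewrite [G _ _]mxE.
  rewrite (@corner_mx_row _ _ _ _ _ _ (green z1 j)) // !mxE.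
  transitivity (free_minus_row z (green z1 j) i).
    by rewrite /free_minus_row /tridiag_row; case: (nat_of_ord i) => [|m]; rewrite sub0r.
  by rewrite -free_minusE free_minus_green.
have DG : D' *m G = \matrix_(i < n.+1, j < n.+1) kernel_entry i j.
  apply/matrixP => i j; rewrite mxE; under eq_bigr do rewrite [G _ _]mxE.
  rewrite (@corner_mx_row _ _ _ _ _ _ (green z1 j)) // !mxE /kernel_entry /tridiag_row /ja'.
  by rewrite (ltn_eqF (ltn_ord i)).
have AD : A0 + D' = corner_mx ja' (fun m => jb J m - (z + z^-1)) (jc J) z n.
  by apply/matrixP => i j; rewrite !mxE /tridiag; ring.
have detA0 : \det A0 * z ^+ n.+1 = (-1) ^+ n.+1.
  rewrite (@det_corner_mx _ (fun=> 1) (fun=> 0)) //.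
  rewrite (@jost_uniq _ _ _ _ _ (fun=> 1)) ?mulr1 // => m _.
    by rewrite mulr0 subr0 mul1r addrAC subrr add0r.
have detAD : \det (A0 + D') * z ^+ n.+1 = (-1) ^+ n.+1 * jost (jb J) (cut_prod n) z n.+1 0.
  rewrite AD det_corner_mx //; last by rewrite /ja' eqxx.
  move=> l l0; rewrite /ja'; case: ifP => _; first exact: oner_neq0.
  by have := jacobi_neq0 J l0; rewrite mulf_eq0 negb_or => /andP[].
have fact : (1%:M + D' *m G) *m A0 = A0 + D'.
  by rewrite mulmxDl mul1mx -mulmxA (mulmx1C A0G) mulmx1.
rewrite -DG; apply: (mulfI (_ : (-1) ^+ n.+1 != 0 :> R[i])).
  by rewrite expf_neq0 // oppr_eq0 oner_neq0.
by rewrite -detAD -fact det_mulmx -mulrA detA0 mulrC.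
Qed.

Lemma jost_cvg_det : 
  (fun n => jost (jb J) (cut_prod n) z n.+1 0) @ \oo --> disk_det J z.
Proof.
rewrite /disk_det (negPf z0).
have := perturbation_det_cvg; rewrite -cvg_shiftS /=.
by rewrite (_ : (fun n => _) = (fun n => jost (jb J) (cut_prod n) z n.+1 0)) //;
  apply/funext => n; rewrite det_kernel.
Qed.

End PerturbationDeterminant.

(** * Bounds for the Volterra kernel, continuity in the spectral parameter *)

Section KernelBounds.
Variable R : realType.
Implicit Types (z : R[i]).

Lemma normc_geo_le z k : normc z <= 1 -> normc (geo z k) <= k%:R.
Proof.
move=> z1; rewrite /geo (le_trans (normc_sum _ _ _)) //.
rewrite -[k in leRHS]card_ord -sumr_const; apply: ler_sum => i _.
by rewrite !normcX exprn_ile1 ?exprn_ge0 ?normc_ge0 // exprn_ile1 ?normc_ge0.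
Qed.

Lemma geo_bound_linear z s k : normc z <= 1 -> (0 < k <= s)%N ->
  normc (z * geo z k) <= normc z * s%:R.
Proof.
move=> z1 /andP[_ ks]; rewrite normcM ler_wpM2l ?normc_ge0 //.
by rewrite (le_trans (normc_geo_le k z1)) // ler_nat.
Qed.

Lemma disk_neq1 z : normc z < 1 -> 1 - z != 0 /\ 1 + z != 0.
Proof.
move=> z1; split; apply: contraTneq z1.
  by move=> /subr0_eq <-; rewrite normc1 ltxx.
by move=> /eqP; rewrite addr_eq0 eq_sym eqr_oppLR => /eqP ->; rewrite normcN normc1 ltxx.
Qed.

(** (1 - z^2) geo z k = 1 - z^(2k). *)
Lemma geo_bound_const z k : normc z < 1 ->
  normc (z * geo z k) <= 2 * normc z / (normc (1 - z) * normc (1 + z)).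
Proof.
move=> z1; have [zm zp] := disk_neq1 z1.
have pos : 0 < normc (1 - z) * normc (1 + z).
  by rewrite mulr_gt0 // lt_neqAle normc_ge0 andbT eq_sym; apply/negP => /eqP/eq0_normc/eqP;
     apply/negP.
rewrite ler_pdivlMr // -!normcM.
have -> : z * geo z k * ((1 - z) * (1 + z)) = z * (1 - (z ^+ 2) ^+ k).
  rewrite -mulrA; congr (z * _); have := subrX1 (z ^+ 2) k; rewrite /geo => E.
  by rewrite -[1 - (z ^+ 2) ^+ k]opprB E; ring.
rewrite normcM mulrC ler_wpM2r ?normc_ge0 // (le_trans (le_normcD _ _)) //.
rewrite normcN normc1 (_ : 2 = 1 + 1 :> R) // lerD2l !normcX.
by rewrite exprn_ile1 ?exprn_ge0 ?normc_ge0 // exprn_ile1 ?normc_ge0 // ltW.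
Qed.

Lemma jost_continuous (b al : nat -> R[i]) N m : continuous (fun z => jost b al z N m).
Proof.
have [k] := ubnP (N - m); elim: k m => // k IH m mk.
have [Nm|mN] := leqP N m.
  rewrite (_ : (fun z => _) = fun=> 1); first exact: cst_continuous.
  by apply/funext => z; rewrite jost_free.
rewrite (_ : (fun z => _) = (fun z => (z ^+ 2 + 1 - z * b m.+1) * jost b al z N m.+1
                    - al m.+1 * z ^+ 2 * jost b al z N m.+2)); last first.
  by apply/funext => z; rewrite jost_rec.
move: mk; rewrite -(subnSK mN) ltnS => mk z.
have c1 : {for z, continuous (fun z => jost b al z N m.+1)} := IH _ mk z.
have c2 : {for z, continuous (fun z => jost b al z N m.+2)}.
  exact: (IH _ (leq_ltn_trans (leq_sub2l N (leqnSn m.+1)) mk) z).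
have cid : {for z, continuous (fun w : R[i] => w)} by exact: cvg_id.
have ccst c : {for z, continuous (fun _ : R[i] => c : R[i])} by exact: cst_continuous.
have csq : {for z, continuous (fun w : R[i] => w ^+ 2)} by exact: continuousM.
have cA := continuousB (continuousD csq (ccst 1)) (continuousM cid (ccst (b m.+1))).
exact: (continuousB (continuousM cA c1)
  (continuousM (continuousM (ccst (al m.+1)) csq) c2)).
Qed.

End KernelBounds.

(** * The estimate inside the disk *)

Section InteriorEstimate.
Variable R : realType.
Implicit Types (z : R[i]).

Lemma lne_le (x y : R) : x <= expR y -> (lne x%:E <= y%:E)%E.
Proof.
move=> xy; rewrite /lne; case: (leP x 0) => [_|x0]; first exact: leNye.
by rewrite lee_fin -[leRHS]expRK ler_ln ?posrE ?expR_gt0.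
Qed.

Variable (J : jacobi R).
Hypothesis hJ : trace_class (jacobi_perturbation J).
Let al m := ja J m * jc J m.

Lemma bounded_terms_cvg0 (f : nat -> R) B : (forall n, 0 <= f n) ->
  (forall N, \sum_(0 <= i < N) f i <= B) -> f @ \oo --> (0 : R).
Proof. by move=> f0 fB; apply: cvg_series_cvg_0; exact: cvg_nneg_series fB. Qed.

Lemma jc_cvg : (fun n => normc (jc J n.+1 - 1)) @ \oo --> (0 : R).
Proof.
have [B BP] := perturbation_summable hJ.
apply: (bounded_terms_cvg0 (B := B)) => N; first exact: normc_ge0.
by have [] := BP N.
Qed.

Lemma ja_cvg : (fun n => normc (ja J n.+1 - 1)) @ \oo --> (0 : R).
Proof.
have [B BP] := perturbation_summable hJ.
apply: (bounded_terms_cvg0 (B := B)) => N; first exact: normc_ge0.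
by have [] := BP N.
Qed.

Lemma cut_prod_lt n j : (j < n)%N -> cut_prod J n j.+1 = al j.+1.
Proof. by move=> jn; rewrite /cut_prod ltn_eqF. Qed.

Lemma cut_prod_last n : cut_prod J n n.+1 = jc J n.+1.
Proof. by rewrite /cut_prod eqxx mul1r. Qed.

Lemma jost_exponent_cut (kappa : nat -> R) n : 0 <= kappa n.+1 ->
  jost_exponent kappa (jb J) (cut_prod J n) n.+1 <=
  jost_exponent kappa (jb J) al n.+1 + kappa n.+1 * normc (jc J n.+1 - 1).
Proof.
move=> k0; rewrite /jost_exponent !big_nat_recr //= -addrA lerD //.
  rewrite !big_nat; apply: ler_sum => j /andP[_ jn].
  by rewrite /free_dist cut_prod_lt.
rewrite -mulrDr ler_wpM2l // /free_dist cut_prod_last [normc (1 - jc _ _)]normc_distC.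
by rewrite lerD2r lerDl normc_ge0.
Qed.

(** The bounds for the truncated Jost functions involve c_(n+1) - 1 at the cut,
which disappears in the limit. *)
Lemma disk_det_bound z (K D : R) : z != 0 -> normc z < 1 ->
  (forall s k, (0 < k <= s)%N -> normc (z * geo z k) <= K) ->
  (forall N, jost_exponent (fun=> K) (jb J) al N <= D) ->
  normc (disk_det J z) <= expR D.
Proof.
move=> z0 z1 KP totD.
have K0 : 0 <= K by apply: le_trans (normc_ge0 _) (KP 1%N 1%N _).
have vD : (fun n => expR (D + K * normc (jc J n.+1 - 1))) @ \oo --> expR D.
  have arg : (fun n => D + K * normc (jc J n.+1 - 1)) @ \oo --> D.
    rewrite -[X in _ --> X]addr0 -[X in _ + X](mulr0 K).
    by apply: cvgD; [exact: cvg_cst|apply: cvgMr; exact: jc_cvg].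
  exact: (continuous_cvg _ (@continuous_expR R D) arg).
apply: (normc_lim_le (jost_cvg_det hJ z0 z1) vD); apply: nearW => n.
apply: le_trans (jost_bound (kappa := fun=> K) (ltW z1) KP _ _ _ _) _.
rewrite ler_expR; apply: le_trans (@jost_exponent_cut (fun=> K) n K0) _.
by rewrite lerD2r.
Qed.

Lemma Delta_partial N :
  ((\sum_(0 <= j < N) free_dist (jb J) al j.+1)%:E <= Delta J)%E.
Proof.
have -> : ((\sum_(0 <= j < N) free_dist (jb J) al j.+1)%:E =
   \sum_(1 <= n < N.+1) (normc (jb J n) + normc (1 - ja J n * jc J n))%:E)%E.
  by rewrite big_add1 /= -sumEFin.
by apply: nneseries_lim_ge => n _ _; rewrite lee_fin addr_ge0 ?normc_ge0.
Qed.

Lemma lne_disk_det_le z : normc z < 1 ->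
  (lne (normc (disk_det J z))%:E <=
      (2 * normc z / (normc (1 - z) * normc (1 + z)))%:E * Delta J)%E.
Proof.
move=> z1; have [->|z0] := eqVneq z 0.
  rewrite /disk_det eqxx normc1 normc0 mulr0 mul0r mul0e.
  by apply: lne_le; rewrite expR0.
set K := 2 * _ / _.
have [zm zp] := disk_neq1 z1.
have npos (w : R[i]) : w != 0 -> 0 < normc w.
  by move=> w0; rewrite lt_neqAle normc_ge0 andbT eq_sym; apply: contraNneq w0 => /eq0_normc ->.
have K0 : 0 < K by rewrite divr_gt0 ?mulr_gt0 ?npos.
have Dpart := Delta_partial.
case: (Delta J) Dpart => [D|_|/(_ 0%N)]; last by rewrite leeNy_eq.
  move=> Dpart; rewrite -EFinM; apply: lne_le.
  apply: (disk_det_bound (K := K)) => // [s k _|N]; first exact: geo_bound_const.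
  by rewrite /jost_exponent -mulr_sumr ler_wpM2l ?(ltW K0) // -lee_fin.
by rewrite gt0_muley ?lte_fin // leey.
Qed.

End InteriorEstimate.

(** * The estimate up to the boundary *)

Section BoundaryEstimate.
Variable R : realType.
Implicit Types (z : R[i]).
Variable (J : jacobi R).
Hypothesis hJ : trace_class (jacobi_perturbation J).
Let al m := ja J m * jc J m.

(** In Delta1 the defect of a_j c_j carries the factor j + 1, while the kernel bound
k |z| only asks for j. *)
Lemma weighted_partial N :
  ((\sum_(0 <= j < N) j.+1%:R * free_dist (jb J) al j.+1)%:E <= Delta1 J)%E.
Proof.
apply: (@le_trans _ _ (\sum_(1 <= n < N.+2)
   (n%:R * (normc (jb J n) + normc (1 - jac J n.-1)))%:E)%E); last first.
  by apply: nneseries_lim_ge => n _ _; rewrite lee_fin mulr_ge0 ?addr_ge0 ?normc_ge0.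
rewrite big_add1 /= sumEFin lee_fin.
under eq_bigr do rewrite mulrDr.
under [leRHS]eq_bigr do rewrite mulrDr.
rewrite !big_split /= lerD //.
  by rewrite [leRHS]big_nat_recr //= lerDl mulr_ge0 ?normc_ge0.
have jac0 : normc (1 - jac J 0) = 0 by rewrite subrr normc0.
rewrite [leRHS]big_nat_recl // jac0 mulr0 add0r.
by apply: ler_sum => j _; rewrite ler_wpM2r ?normc_ge0 // ler_nat.
Qed.

Variable (D : R).
Hypothesis D_bound : forall N, \sum_(0 <= j < N) j.+1%:R * free_dist (jb J) al j.+1 <= D.

Let W := series (fun j => j.+1%:R * free_dist (jb J) al j.+1).

Let W_term_ge0 j : 0 <= j.+1%:R * free_dist (jb J) al j.+1.
Proof. by rewrite mulr_ge0 ?free_dist_ge0. Qed.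

Let W_cvg : cvgn W.
Proof. exact: cvg_nneg_series D_bound. Qed.

Let W_le n : W n <= limn W.
Proof. exact: nneg_series_le_lim. Qed.

Lemma jost_exponent_linear z N :
  jost_exponent (fun s => normc z * s%:R) (jb J) al N = normc z * W N.
Proof. by rewrite /jost_exponent /W /series /= mulr_sumr; apply: eq_bigr => j _; rewrite mulrA. Qed.

Lemma jost_linear_bound z N : normc z <= 1 ->
  normc (jost (jb J) al z N 0) <= expR (normc z * D).
Proof.
move=> z1; apply: le_trans (jost_bound z1 (fun s k => geo_bound_linear z1) _ _ _ _) _.
by rewrite ler_expR jost_exponent_linear ler_wpM2l ?normc_ge0 // D_bound.
Qed.

(** Uniform in z, hence the continuity of the limit. *)
Lemma jost_cauchy z m n : normc z <= 1 -> (m <= n)%N ->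
  normc (jost (jb J) al z n 0 - jost (jb J) al z m 0) <=
  (limn W - W m) * expR D * expR D.
Proof.
move=> z1 mn.
pose b' s := if (s <= m)%N then jb J s else 0.
pose al' s := if (s <= m)%N then al s else 1.
rewrite -[jost _ _ z m 0](jost_trunc _ _ _ mn).
have zW N : normc z * W N <= D.
  by rewrite (le_trans _ (D_bound N)) // ler_piMl // /W /series /= sumr_ge0 // => j _;
     rewrite mulr_ge0 ?free_dist_ge0.
have tot : jost_exponent (fun s => normc z * s%:R) (jb J) al n <= D by rewrite jost_exponent_linear.
have tot' : jost_exponent (fun s => normc z * s%:R) b' al' n <= D.
  apply: le_trans tot; apply: ler_sum => j _; rewrite ler_wpM2l ?mulr_ge0 ?normc_ge0 //.
  rewrite /free_dist /b' /al'; case: ifP => _; first exact: lexx.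
  by rewrite subrr normc0 addr0 addr_ge0 ?normc_ge0.
apply: le_trans (jost_stability z1 (fun s k => geo_bound_linear z1) _ _ _ _ _ _) _.
apply: ler_pM; rewrite ?expR_ge0 ?ler_expR //.
  rewrite mulr_ge0 ?expR_ge0 // sumr_ge0 // => j _.
  by rewrite !mulr_ge0 ?addr_ge0 ?normc_ge0.
apply: ler_pM; rewrite ?expR_ge0 ?ler_expR //.
  by rewrite sumr_ge0 // => j _; rewrite !mulr_ge0 ?addr_ge0 ?normc_ge0.
apply: (@le_trans _ _ (W n - W m)); last by rewrite lerD2r.
rewrite (big_cat_nat (leq0n m) mn) /= big1_seq ?add0r => [|j].
  rewrite /W /series /= (big_cat_nat (leq0n m) mn) /= addrAC subrr add0r.
  rewrite !big_nat; apply: ler_sum => j /andP[mj _].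
  rewrite ltnNge mj /= subr0 -mulrA /free_dist [normc (1 - _)]normc_distC.
  by rewrite ler_piMl ?mulr_ge0 ?addr_ge0 ?normc_ge0.
rewrite mem_index_iota => /andP[_ /andP[_ jm]].
by rewrite jm !subrr normc0 addr0 mulr0.
Qed.

Definition disk_det_ext z := limn (fun n => jost (jb J) al z n 0).

Let e n := (limn W - W n) * expR D * expR D.

Let e_cvg0 : e @ \oo --> (0 : R).
Proof.
have -> : e = fun n => (expR D * expR D) * (limn W - W n).
  by apply/funext => n; rewrite /e; ring.
rewrite -[X in _ --> X](mulr0 (expR D * expR D)) -(subrr (limn W)); apply: cvgMr.
by apply: cvgB; [exact: cvg_cst|exact: W_cvg].
Qed.

Lemma disk_det_extP z : normc z <= 1 ->
  (fun n => jost (jb J) al z n 0) @ \oo --> disk_det_ext z /\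
  forall n, normc (disk_det_ext z - jost (jb J) al z n 0) <= e n.
Proof.
move=> z1; have [l [ul le]] := complex_cauchy e_cvg0 (fun m n => @jost_cauchy z m n z1).
by rewrite /disk_det_ext (complex_limn ul).
Qed.

Lemma disk_det_ext_bound z : normc z <= 1 -> normc (disk_det_ext z) <= expR (normc z * D).
Proof.
move=> z1; apply: (normc_lim_le (disk_det_extP z1).1 (cvg_cst _)); apply: nearW => n.
exact: jost_linear_bound.
Qed.

Lemma disk_det_ext_continuous :
  {within [set z : R[i] | normc z <= 1], continuous disk_det_ext}.
Proof.
apply/subspace_continuousP => z /= z1; apply/cvg_normcP.
apply/cvgrPdist_lt => d d0.
have d3 : 0 < d / 3 by rewrite divr_gt0.
have /cvgrPdist_lt/(_ _ d3) [n _ /(_ n (leqnn n))] := e_cvg0.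
rewrite /= sub0r normrN => en; have {}en : e n < d / 3 by exact: le_lt_trans (ler_norm _) en.
have /cvg_normcP/cvgrPdist_lt/(_ _ d3) := @jost_continuous R (jb J) al n 0 z.
move=> near_z; near=> w.
have w1 : normc w <= 1 by near: w; exact: withinT.
rewrite sub0r normrN ger0_norm ?normc_ge0 //.
have -> : disk_det_ext w - disk_det_ext z = (disk_det_ext w - jost (jb J) al w n 0)
   + (jost (jb J) al w n 0 - jost (jb J) al z n 0)
   - (disk_det_ext z - jost (jb J) al z n 0) by ring.
rewrite (le_lt_trans (le_normcD _ _)) // normcN.
have -> : d = d / 3 + d / 3 + d / 3 by field.
rewrite ltrD // ?(le_lt_trans ((disk_det_extP z1).2 n)) //.
rewrite (le_lt_trans (le_normcD _ _)) // ltrD //.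
  by rewrite (le_lt_trans ((disk_det_extP w1).2 n)).
rewrite -[ltLHS]ger0_norm ?normc_ge0 // -normrN -sub0r.
by near: w; apply: cvg_within near_z.
Unshelve. all: by end_near. Qed.

(** The Jost functions with al and with [cut_prod] differ only at the site n + 1,
by c_(n+1) (a_(n+1) - 1), so they have the same limit by stability.  The linear
kernel bound would multiply this difference by n + 1, so the constant one is
used here. *)
Lemma disk_det_ext_interior z : normc z < 1 -> disk_det_ext z = disk_det J z.
Proof.
move=> z1; have [->|z0] := eqVneq z 0.
  rewrite /disk_det eqxx; apply: complex_limn.
  rewrite (_ : (fun n => _) = fun=> 1); first exact: cvg_cst.
  apply/funext => n; apply: (@jost_uniq _ _ _ _ _ (fun=> 1)) => // m _.
  by rewrite expr0n mul0r !mulr0 mul0r !subr0 add0r mulr1.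
pose K := 2 * normc z / (normc (1 - z) * normc (1 + z)).
have KP s k : (0 < k <= s)%N -> normc (z * geo z k) <= K.
  by move=> _; exact: geo_bound_const.
have K0 : 0 <= K by apply: le_trans (normc_ge0 _) (KP 1%N 1%N _).
have [B BP] := perturbation_summable hJ.
have [M MP] := jacobi_bounded J.
have jcB n : normc (jc J n.+1 - 1) <= B.
  have [_ _] := BP n.+1; apply: le_trans.
  by rewrite big_nat_recr //= lerDr sumr_ge0 // => *; exact: normc_ge0.
have totK N : jost_exponent (fun=> K) (jb J) al N <= K * D.
  rewrite /jost_exponent -mulr_sumr ler_wpM2l //; apply: le_trans (D_bound N).
  by apply: ler_sum => j _; rewrite ler_peMl ?free_dist_ge0 // ler1n.
pose E := expR (K * D + K * B) * expR (K * D).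
have E0 : 0 <= E by rewrite mulr_ge0 ?expR_ge0.
have diff n : normc (jost (jb J) al z n.+1 0 - jost (jb J) (cut_prod J n) z n.+1 0)
    <= K * M * E * normc (ja J n.+1 - 1).
  apply: le_trans (jost_stability (kappa := fun=> K) (ltW z1) KP _ _ _ _ _ _) _.
  have -> : K * M * E * normc (ja J n.+1 - 1) =
     K * (M * normc (ja J n.+1 - 1)) * expR (K * D + K * B) * expR (K * D).
    by rewrite /E; ring.
  rewrite big_nat_recr //= big1_seq ?add0r => [|j]; last first.
    rewrite mem_index_iota => /andP[_ /andP[_ jn]].
    by rewrite cut_prod_lt // !subrr normc0 addr0 mulr0.
  rewrite cut_prod_last subrr normc0 add0r.
  apply: ler_pM; rewrite ?expR_ge0 ?ler_expR ?totK //.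
    by rewrite mulr_ge0 ?expR_ge0 // mulr_ge0 ?normc_ge0.
  apply: ler_pM; rewrite ?expR_ge0 ?ler_expR //.
  - by rewrite mulr_ge0 ?normc_ge0.
  - rewrite ler_wpM2l // (_ : _ - _ = jc J n.+1 * (ja J n.+1 - 1)); last by rewrite /al; ring.
    by rewrite normcM ler_wpM2r ?normc_ge0 //; have [] := MP n.+1 isT.
  - apply: le_trans (@jost_exponent_cut _ _ (fun=> K) n K0) _.
    by rewrite lerD // ?totK // ler_wpM2l.
apply: complex_limn; rewrite -cvg_shiftS; apply/cvgn_normcP.
have c1 := (cvgn_normcP _ _).1 (jost_cvg_det hJ z0 z1).
have c2 : (fun n => K * M * E * normc (ja J n.+1 - 1)) @ \oo --> (0 : R).
  by rewrite -[X in _ --> X](mulr0 (K * M * E)); apply: cvgMr; exact: ja_cvg.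
have c12 : (fun n => K * M * E * normc (ja J n.+1 - 1) +
    normc (jost (jb J) (cut_prod J n) z n.+1 0 - disk_det J z)) @ \oo --> (0 : R).
  by rewrite -[X in _ --> X](addr0 0); apply: cvgD.
apply: cvgn_le0 c12 => n; rewrite normc_ge0 /=.
rewrite -[jost _ al z n.+1 0 - _](subrKA (jost (jb J) (cut_prod J n) z n.+1 0)).
by rewrite (le_trans (le_normcD _ _)) // lerD.
Qed.

End BoundaryEstimate.

Theorem theorem2p1 (R : realType) (J : jacobi R)
    (hJ : trace_class (jacobi_perturbation J)) :
  (forall z : R[i], normc z < 1 ->
     (lne (normc (disk_det J z))%:E <=
      (2 * normc z / (normc (1 - z) * normc (1 + z)))%:E * Delta J)%E) /\
  ((Delta1 J < +oo)%E ->
   exists F : R[i] -> R[i],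
     [/\ {within [set z : R[i] | normc z <= 1], continuous F},
         forall z : R[i], normc z < 1 -> F z = disk_det J z &
         forall z : R[i], normc z <= 1 ->
           (lne (normc (F z))%:E <= (normc z)%:E * Delta1 J)%E]).
Proof.
split; first exact: lne_disk_det_le.
have := @weighted_partial R J.
case: (Delta1 J) => [D Dw _|//|/(_ 0%N)]; last by rewrite leeNy_eq.
have DB N :
    \sum_(0 <= j < N) j.+1%:R * free_dist (jb J) (fun m => ja J m * jc J m) j.+1 <= D.
  by rewrite -lee_fin.
exists (disk_det_ext J); split.
- exact: disk_det_ext_continuous DB.
- exact: disk_det_ext_interior DB.
- move=> z z1; rewrite -EFinM; apply: lne_le; exact: disk_det_ext_bound.
Qed.
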